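(* Let $M$ be a finitely generated multigraded $S$-module, and let $d$ be an integer. Then $M$ has a $d$-linear resolution (over $S$) if and only if $M^*$ has a $d$-linear resolution (over $S^*$).
   Context: Let $K$ be a field and $S=K[x_1,\ldots,x_n]$. Fix an $n$-tuple $(i_1,\ldots,i_n)$ of positive integers, let $S^*$ be the polynomial ring over $K$ in the variables $x_{jk}$, $1\le j\le n$, $1\le k\le i_j$, and set $P_j=(x_{j1},\ldots,x_{ji_j})\subseteq S^*$. For $\mathbf{a}=(a(1),\ldots,a(n))\in\mathbb{N}^n$ put $(\mathbf{x}^{\mathbf{a}})^*=P_1^{a(1)}\cdots P_n^{a(n)}\subseteq S^*$. Polynomial rings carry the standard multigrading (by exponent vectors of monomials). Multigraded $S$-modules are understood to be $\mathbb{N}^n$-graded, so all shifts of multigraded free modules lie in $\mathbb{N}^n$; free modules are finitely generated. For $F=\bigoplus_i S(-\mathbf{a}_i)$ put $F^*=\bigoplus_i(\mathbf{x}^{\mathbf{a}_i})^*$. A multigraded homomorphism $\alpha:\bigoplus_{i=1}^r S(-\mathbf{a}_i)\to\bigoplus_{j=1}^s S(-\mathbf{b}_j)$ has components $f\mapsto \lambda_{ji}\mathbf{x}^{\mathbf{a}_i-\mathbf{b}_j}f$ with $\lambda_{ji}\in K$ and $\lambda_{ji}=0$ if $\mathbf{x}^{\mathbf{b}_j}\nmid\mathbf{x}^{\mathbf{a}_i}$. Define $\alpha^*:\bigoplus_i(\mathbf{x}^{\mathbf{a}_i})^*\to\bigoplus_j(\mathbf{x}^{\mathbf{b}_j})^*$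 as the map with components $f\mapsto\lambda_{ji}f$ if $\mathbf{x}^{\mathbf{b}_j}\mid\mathbf{x}^{\mathbf{a}_i}$, and zero otherwise. For a finitely generated multigraded $S$-module $M$, choose a multigraded free presentation $F_1\xrightarrow{\varphi}F_0\to M\to0$ and set $M^*=\operatorname{Coker}\varphi^*$ (well defined up to isomorphism); $M^*$ is the expansion of $M$ with respect to $(i_1,\ldots,i_n)$. A graded module has a $d$-linear resolution if its graded Betti numbers (with respect to total degree) satisfy $\beta_{j,k}=0$ whenever $k\ne d+j$. *)

(* Defs.v *)
From HB Require Import structures.
From mathcomp Require Import all_boot all_order all_algebra.
From mathcomp Require Import boolp.
From mathcomp Require Import mpoly.

Set Implicit Arguments.
Unset Strict Implicit.
Unset Printing Implicit Defensive.

Import GRing.Theory.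
Local Open Scope ring_scope.
Local Open Scope quotient_scope.

(* Elements of a free module of rank r are row vectors 'rV_r; a map between   *)
(* free modules given by a matrix A acts on the right, v |-> v *m A, so that  *)
(* A i j is the component from the i-th to the j-th summand.                  *)

Section Multigraded.
Variables (K : fieldType) (n : nat).

Record is_multigrading (M : lmodType {mpoly K[n]})
    (P : 'X_{1..n} -> M -> Prop) : Prop := {
  multigrading0 : forall a, P a 0;
  multigradingD : forall a u v, P a u -> P a v -> P a (u + v);
  (* for a = 0 this is the stability of P b under scalars of K *)
  multigradingZ : forall a b (c : K) v,
    P b v -> P (a + b)%MM ((c *: 'X_[a]) *: v);
  multigrading_span : forall v, exists (s : seq 'X_{1..n}) (f : 'X_{1..n} -> M),
    (forall a, P a (f a)) /\ v = \sum_(a <- s) f a;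
  multigrading_direct : forall (s : seq 'X_{1..n}) (f : 'X_{1..n} -> M),
    uniq s -> (forall a, P a (f a)) -> \sum_(a <- s) f a = 0 ->
    forall a, a \in s -> f a = 0
}.

Record multigradedModule := MultigradedModule {
  mgmod_sort :> lmodType {mpoly K[n]};
  mpiece : 'X_{1..n} -> mgmod_sort -> Prop;
  mpieceP : is_multigrading mpiece
}.

Definition total_piece (M : multigradedModule) (k : int) (v : M) : Prop :=
  exists (s : seq 'X_{1..n}) (f : 'X_{1..n} -> M),
    (forall a, a \in s -> mpiece a (f a) /\ (mdeg a)%:Z = k) /\
    v = \sum_(a <- s) f a.

Definition finitely_generated (M : lmodType {mpoly K[n]}) : Prop :=
  exists (r : nat) (g : 'I_r -> M),
    forall v, exists c : 'I_r -> {mpoly K[n]}, v = \sum_i c i *: g i.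

(* The homogeneous elements of multidegree c in the direct sum of the S(-a l) *)
Definition free_mpiece r (a : 'I_r -> 'X_{1..n}) (c : 'X_{1..n})
    (v : 'rV[{mpoly K[n]}]_r) : Prop :=
  forall l m, m \in msupp (v 0 l) -> (m + a l)%MM = c.

Record mghom r s (a : 'I_r -> 'X_{1..n}) (b : 'I_s -> 'X_{1..n}) := MgHom {
  mghom_coef : 'M[K]_(r, s);
  mghom_coef0 : forall i j, ~~ (b j <= a i)%MM -> mghom_coef i j = 0
}.

Definition mghom_mx r s (a : 'I_r -> 'X_{1..n}) (b : 'I_s -> 'X_{1..n})
    (phi : mghom a b) : 'M[{mpoly K[n]}]_(r, s) :=
  \matrix_(i, j) (mghom_coef phi i j *: 'X_[(a i - b j)%MM]).

Record free_presentation (M : multigradedModule) := FreePresentation {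
  pres_rank1 : nat;
  pres_rank0 : nat;
  pres_shift1 : 'I_pres_rank1 -> 'X_{1..n};
  pres_shift0 : 'I_pres_rank0 -> 'X_{1..n};
  pres_map : mghom pres_shift1 pres_shift0;
  pres_aug : {linear 'rV[{mpoly K[n]}]_pres_rank0 -> M};
  pres_aug_graded : forall c v,
    free_mpiece pres_shift0 c v -> mpiece c (pres_aug v);
  pres_aug_surj : forall x : M, exists v, pres_aug v = x;
  pres_exact : forall v,
    pres_aug v = 0 <-> exists u, v = u *m mghom_mx pres_map
}.

End Multigraded.

Arguments pres_shift1 [K n M] _ _.
Arguments pres_shift0 [K n M] _ _.

Section Resolution.
Variables (K : fieldType) (m : nat).
Local Notation R := {mpoly K[m]}.

(* The homogeneous elements of degree k in the direct sum of the R(- c l) *)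
Definition free_piece r (c : 'I_r -> int) (k : int) (v : 'rV[R]_r) : Prop :=
  forall l a, a \in msupp (v 0 l) -> (mdeg a)%:Z + c l = k.

(* The augmented complex ... -> F_2 -> F_1 -> F_0 -> N -> 0, where F_j is the *)
(* direct sum of the R(- res_shift j l) and [piece k] is the component of N   *)
(* of degree k. Minimality: the image of F_{j+1} lies in (x_1,...,x_m)F_j.    *)
Record min_graded_res (N : lmodType R) (piece : int -> N -> Prop) :=
  MinGradedRes {
  res_rank : nat -> nat;
  res_shift : forall j, 'I_(res_rank j) -> int;
  res_diff : forall j, 'M[R]_(res_rank j.+1, res_rank j);
  res_aug : {linear 'rV[R]_(res_rank 0) -> N};
  res_diff_graded : forall j k v, free_piece (@res_shift j.+1) k v ->
    free_piece (@res_shift j) k (v *m res_diff j);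
  res_aug_graded : forall k v,
    free_piece (@res_shift 0) k v -> piece k (res_aug v);
  res_aug_surj : forall x : N, exists v, res_aug v = x;
  res_exact0 : forall v, res_aug v = 0 <-> exists u, v = u *m res_diff 0;
  res_exactS : forall j (v : 'rV[R]_(res_rank j.+1)),
    v *m res_diff j = 0 <-> exists u, v = u *m res_diff j.+1;
  res_minimal : forall j i l, (res_diff j i l)@_(0%MM) = 0
}.

Definition graded_betti (N : lmodType R) (piece : int -> N -> Prop)
    (F : min_graded_res piece) (j : nat) (k : int) : nat :=
  #|[set l : 'I_(res_rank F j) | @res_shift _ _ F j l == k]|.

(* The minimal graded free resolution of a finitely generated graded module   *)
(* is unique up to isomorphism, hence so are its graded Betti numbers.        *)
Definition has_linear_resolution (d : int) (N : lmodType R)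
    (piece : int -> N -> Prop) : Prop :=
  exists F : min_graded_res piece,
    forall (j : nat) (k : int), k != d + j%:Z -> graded_betti F j k = 0%N.

End Resolution.

Arguments res_shift [K m N piece] _ j _.

Section Cokernel.
Variables (R : pzRingType) (U V : lmodType R) (f : {linear U -> V}).

Definition im_lin : {pred V} := fun v => `[< exists u, f u = v >].

Fact im_lin_zmod_closed : zmod_closed im_lin.
Proof.
split; first by apply/asboolP; exists 0; rewrite linear0.
move=> _ _ /asboolP[x <-] /asboolP[y <-].
by apply/asboolP; exists (x - y); rewrite linearB.
Qed.

HB.instance Definition _ := GRing.isZmodClosed.Build V im_lin
  im_lin_zmod_closed.

Definition coker := Quotient.quot im_lin.
HB.instance Definition _ := GRing.Zmodule.on coker.

Definition coker_proj (v : V) : coker := \pi_(Quotient.quot im_lin) v.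

Lemma coker_projP u v :
  coker_proj u = coker_proj v <-> exists x, f x = u - v.
Proof.
rewrite /coker_proj; split.
  by move/eqP; rewrite -Quotient.idealrBE => /asboolP.
by move=> h; apply/eqP; rewrite -Quotient.idealrBE; apply/asboolP.
Qed.

Lemma coker_proj_surj (q : coker) : exists v, coker_proj v = q.
Proof. by exists (repr q); rewrite /coker_proj reprK. Qed.

Fact coker_projB : zmod_morphism coker_proj.
Proof.
by move=> x y; rewrite /coker_proj raddfB.
Qed.

HB.instance Definition _ := GRing.isZmodMorphism.Build V coker coker_proj
  coker_projB.

Definition coker_scale (c : R) (q : coker) : coker := coker_proj (c *: repr q).

Lemma coker_scale_proj c v : coker_scale c (coker_proj v) = coker_proj (c *: v).
Proof.
apply/coker_projP.
have /coker_projP[x fx] : coker_proj (repr (coker_proj v)) = coker_proj v.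
  by rewrite {1}/coker_proj reprK.
by exists (c *: x); rewrite linearZ /= fx scalerBr.
Qed.

Fact coker_scaleA a b q :
  coker_scale a (coker_scale b q) = coker_scale (a * b) q.
Proof. by case: (coker_proj_surj q) => v <-; rewrite !coker_scale_proj scalerA. Qed.

Fact coker_scale1 : left_id 1 coker_scale.
Proof. by move=> q; case: (coker_proj_surj q) => v <-; rewrite coker_scale_proj scale1r. Qed.

Fact coker_scaleDr : right_distributive coker_scale +%R.
Proof.
move=> c p q; case: (coker_proj_surj p) (coker_proj_surj q) => u <- [v <-].
by rewrite -raddfD !coker_scale_proj scalerDr raddfD.
Qed.

Fact coker_scaleDl q : {morph coker_scale^~ q : a b / a + b}.
Proof.
move=> a b; case: (coker_proj_surj q) => v <-.
by rewrite !coker_scale_proj scalerDl raddfD.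
Qed.

HB.instance Definition _ := GRing.Zmodule_isLmodule.Build R coker
  coker_scaleA coker_scale1 coker_scaleDr coker_scaleDl.

Fact coker_proj_scalable : scalable coker_proj.
Proof. by move=> c v; rewrite -coker_scale_proj. Qed.

HB.instance Definition _ := GRing.isScalable.Build R V coker *:%R coker_proj
  coker_proj_scalable.

End Cokernel.

Section Ideals.
Variable R : comPzRingType.
Implicit Types (A I J : R -> Prop).

Definition ideal_gen A (f : R) : Prop :=
  exists (r : nat) (c g : 'I_r -> R),
    (forall i, A (g i)) /\ f = \sum_i c i * g i.

Definition ideal_mul I J : R -> Prop :=
  ideal_gen (fun h => exists f g, [/\ I f, J g & h = f * g]).

Definition ideal_unit : R -> Prop := fun=> True.

Definition ideal_exp I (k : nat) : R -> Prop := iter k (ideal_mul I) ideal_unit.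

Definition ideal_closed I : Prop :=
  [/\ I 0, forall f g, I f -> I g -> I (f + g) & forall c f, I f -> I (c * f)].

Lemma ideal_closed_sum I (T : Type) (s : seq T) (F : T -> R) :
  ideal_closed I -> (forall t, I (F t)) -> I (\sum_(t <- s) F t).
Proof. by case=> I0 ID _ IF; elim/big_ind: _. Qed.

Lemma ideal_gen_closed A : ideal_closed (ideal_gen A).
Proof.
split.
- by exists 0%N, (fun=> 0), (fun=> 0); split=> [[]|]; rewrite ?big_ord0.
- move=> _ _ [r [c [g [Ag ->]]]] [s [e [h [Ah ->]]]].
  exists (r + s)%N, (fun i => match split i with inl x => c x | inr y => e y end),
    (fun i => match split i with inl x => g x | inr y => h y end).
  split=> [i|]; first by case: (split i).
  rewrite big_split_ord /=; congr (_ + _); apply: eq_bigr => i _.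
    by rewrite (unsplitK (inl _ i)).
  by rewrite (unsplitK (inr _ i)).
- move=> a _ [r [c [g [Ag ->]]]]; exists r, (fun i => a * c i), g; split=> //.
  by rewrite mulr_sumr; apply: eq_bigr => i _; rewrite mulrA.
Qed.

Lemma ideal_mul_closed I J : ideal_closed (ideal_mul I J).
Proof. exact: ideal_gen_closed. Qed.

Lemma ideal_unit_closed : ideal_closed ideal_unit.
Proof. by []. Qed.

Lemma ideal_exp_closed I k : ideal_closed (ideal_exp I k).
Proof. by case: k => [|k]; [exact: ideal_unit_closed|exact: ideal_mul_closed]. Qed.

Lemma ideal_mul_mono I I' J J' :
  (forall f, I f -> I' f) -> (forall f, J f -> J' f) ->
  forall f, ideal_mul I J f -> ideal_mul I' J' f.
Proof.
move=> sI sJ f [r [c [g [Ag ->]]]]; exists r, c, g; split=> // i.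
by case: (Ag i) => x [y [Ix Jy ->]]; exists x, y; split; auto.
Qed.

Lemma ideal_mul_subr I J : ideal_closed J ->
  forall f, ideal_mul I J f -> J f.
Proof.
move=> JI f [r [c [g [Ag ->]]]]; apply: ideal_closed_sum => // i.
case: (Ag i) => x [y [_ Jy ->]]; case: JI => _ _ JM.
by apply: (JM); apply: JM.
Qed.

Lemma ideal_exp_anti I k l : (k <= l)%N ->
  forall f, ideal_exp I l f -> ideal_exp I k f.
Proof.
move/subnK=> <-; elim: (l - k)%N => [//|q IHq] f.
by rewrite addSn => /ideal_mul_subr H; apply/IHq/H/ideal_exp_closed.
Qed.

End Ideals.

Section Expansion.
Variables (K : fieldType) (n : nat) (i_ : 'I_n -> nat).

(* S^*: the variable x_{jk} is the variable of index v where                  *)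
(* tagnat.sig1 v = j and tagnat.sig2 v = k.                                   *)
Notation Sstar := {mpoly K[(\sum_(j < n) i_ j)%N]}.

Definition var_ideal (j : 'I_n) : Sstar -> Prop :=
  ideal_gen (fun f => exists v : 'I_(\sum_(j < n) i_ j)%N,
               tagnat.sig1 v = j /\ f = 'X_v).

Definition monomial_star (a : 'X_{1..n}) : Sstar -> Prop :=
  \big[@ideal_mul _/@ideal_unit _]_(j < n) ideal_exp (var_ideal j) (a j).

Lemma monomial_star_closed a : ideal_closed (monomial_star a).
Proof.
apply: (big_ind (@ideal_closed _)) => [|I J _ _|j _].
- exact: ideal_unit_closed.
- exact: ideal_mul_closed.
- exact: ideal_exp_closed.
Qed.

Lemma monomial_star_anti a b : (a <= b)%MM ->
  forall f, monomial_star b f -> monomial_star a f.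
Proof.
move/mnm_lepP=> le_ab; rewrite /monomial_star.
apply: (big_rec2 (fun J I : Sstar -> Prop => forall f, I f -> J f)) => // j I J _ sJI.
by apply: ideal_mul_mono => //; apply: ideal_exp_anti.
Qed.

Definition free_star_pred r (a : 'I_r -> 'X_{1..n}) : {pred 'rV[Sstar]_r} :=
  fun w => `[< forall l, monomial_star (a l) (w 0 l) >].

Fact free_star_submod_closed r (a : 'I_r -> 'X_{1..n}) :
  submod_closed (free_star_pred a).
Proof.
split; first by apply/asboolP=> l; rewrite mxE; case: (monomial_star_closed (a l)).
move=> c u v /asboolP hu /asboolP hv; apply/asboolP=> l; rewrite !mxE.
by case: (monomial_star_closed (a l)) => _ D M; apply: D => //; apply: M.
Qed.

HB.instance Definition _ r (a : 'I_r -> 'X_{1..n}) :=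
  GRing.isSubmodClosed.Build Sstar 'rV[Sstar]_r (free_star_pred a)
    (free_star_submod_closed a).

(* F^* for F the direct sum of the S(-a l), as a submodule of a free module  *)
Record free_star r (a : 'I_r -> 'X_{1..n}) := FreeStar {
  free_star_val :> 'rV[Sstar]_r;
  free_starP : free_star_val \in free_star_pred a
}.

Section FreeStarLmod.
Variables (r : nat) (a : 'I_r -> 'X_{1..n}).
HB.instance Definition _ := [isSub for @free_star_val r a].
HB.instance Definition _ := [Choice of free_star a by <:].
HB.instance Definition _ := [SubChoice_isSubLmodule of free_star a by <:].
End FreeStarLmod.

Section StarMap.
Variables (r s : nat) (a : 'I_r -> 'X_{1..n}) (b : 'I_s -> 'X_{1..n}).
Variable phi : mghom K a b.

Definition star_mx : 'M[Sstar]_(r, s) :=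
  \matrix_(i, j) (if (b j <= a i)%MM then (mghom_coef phi i j)%:MP else 0).

Fact star_map_subproof (w : free_star a) :
  (w : 'rV_r) *m star_mx \in free_star_pred b.
Proof.
case: w => w /= /asboolP hw; apply/asboolP=> l; rewrite mxE.
have [b0 bD bM] := monomial_star_closed (b l).
apply: ideal_closed_sum => // i; rewrite mxE.
case: ifP => [le_ba|_]; last by rewrite mulr0.
by rewrite mulrC; apply/bM/(monomial_star_anti le_ba).
Qed.

Definition star_map (w : free_star a) : free_star b :=
  FreeStar (star_map_subproof w).

Fact star_map_linear : linear star_map.
Proof. by move=> c u v; apply: val_inj; rewrite /= mulmxDl scalemxAl. Qed.

HB.instance Definition _ := GRing.isLinear.Build Sstar (free_star a)
  (free_star b) *:%R star_map star_map_linear.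

End StarMap.

Section ExpansionOfModule.
Variables (M : multigradedModule K n) (F : free_presentation M).

Definition expansion : lmodType Sstar := coker (star_map (pres_map F)).

(* The ideals (x^a)^* are not shifted: they are graded as ideals of S^*.      *)
Definition expansion_piece (k : int) (v : expansion) : Prop :=
  exists w : free_star (pres_shift0 F),
    @free_piece K _ _ (fun=> 0) k (w : 'rV_(pres_rank0 F)) /\
    coker_proj (star_map (pres_map F)) w = v.

End ExpansionOfModule.

End Expansion.

(* Main.v *)
Require Import Defs.
From HB Require Import structures.
From mathcomp Require Import all_boot all_order all_algebra.
From mathcomp Require Import boolp.
From mathcomp Require Import mpoly zify.

(* Let E be M or M^*. Koszul homology tells whether E has a d-linear           *)
(* resolution: this holds iff the Koszul homology of E on all the variables   *)
(* vanishes outside the strand of internal degree d. One direction lifts      *)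
(* cycles along the resolution, by acyclicity of the Koszul complexes of free *)
(* modules; conversely the vanishing implies that E is generated in degree d, *)
(* and it passes, with d + 1 for d, to the kernel of the free cover given by  *)
(* a basis of the degree d part.                                              *)
(*   Let pi b be the multidegree obtained from b by adding the exponents of   *)
(* the x_{jk} for each j. In multidegree b the module M^* is M_(pi b), and    *)
(* x_{jk} acts on it as x_j. So the Koszul complex of M^* in multidegree b is *)
(* that of M in multidegree pi b, on the list of the x_j repeated as many     *)
(* times as there are x_{jk} in the support of b. Replacing e' by e' - e for  *)
(* two copies e, e' of the same Koszul generator removes repetitions at the   *)
(* cost of shifts that do not change the internal degree; hence the vanishing *)
(* condition is the same for M and for M^*.                                   *)

(** [linear_resolution_pullback] carries the argument. Suppose E is a [pullback] of M along a
    surjection of variables, and the components of M are finite-dimensional ([fin_dim_mpiece]). Then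
    E has a d-linear resolution iff M satisfies a condition in which E does not occur: [kmult_exact]
    for all admissible lists of variables. This applies to M by [pullback_id] and to M^* by
    [pullback_expansion]. Resolutions and Koszul homology are compared in
    [linear_resolution_klinear] and [klinear_resolution], and repeated variables are removed in
    [kmult_exact_dup]. *)

Set Implicit Arguments.
Unset Strict Implicit.
Unset Printing Implicit Defensive.

Import Order.TTheory GRing.Theory Num.Theory.
Local Open Scope ring_scope.

(** * Koszul complexes *)

Section Koszul.
Variable R : comPzRingType.

(* The Koszul complex on a list [s] of scalars is the iterated mapping cone:  *)
(* the chains on [j :: s] are the pairs (a, c) = a + e_j c with a, c chains   *)
(* on [s].                                                                    *)
Fixpoint kos (E : lmodType R) (k : nat) : lmodType R :=
  if k is k'.+1 then ((kos E k' * kos E k')%type : lmodType R) else E.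

Arguments kos : simpl never.

Fixpoint kdiff (T : Type) (x : T -> R) (E : lmodType R) (s : seq T) :
    kos E (size s) -> kos E (size s) :=
  if s is j :: s' then fun z => (kdiff x z.1 + x j *: z.2, - kdiff x z.2)
  else fun=> 0.

Fixpoint kall (E : lmodType R) (P : E -> Prop) k : kos E k -> Prop :=
  if k is k'.+1 then fun z => kall P z.1 /\ kall P z.2 else P.

(* The components of exterior degree at least [i] vanish. *)
Fixpoint hdlt (E : lmodType R) k (i : nat) : kos E k -> Prop :=
  if k is k'.+1 then fun z => hdlt i z.1 /\ hdlt i.-1 z.2
  else fun z => i = 0%N -> z = 0.

Fixpoint kmap (E F : lmodType R) (f : E -> F) k : kos E k -> kos F k :=
  if k is k'.+1 then fun z => (kmap f z.1, kmap f z.2) else f.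

(** The component of exterior degree 0; [kbase] is the inclusion of that summand. *)
Fixpoint kfst (E : lmodType R) k : kos E k -> E :=
  if k is k'.+1 then fun z => kfst z.1 else id.

Fixpoint kbase (E : lmodType R) k (u : E) : kos E k :=
  if k is k'.+1 then (kbase k' u, 0) else u.

Section Chains.
Variables (E : lmodType R) (k : nat).
Implicit Types z w : kos E k.

Lemma kall_mono (P Q : E -> Prop) z :
  (forall u, P u -> Q u) -> kall P z -> kall Q z.
Proof.
move=> PQ; elim: k z => [|k' IHk] /=; first exact: PQ.
by case=> a c [/IHk ? /IHk ?].
Qed.

Lemma kall_and (P Q : E -> Prop) z :
  kall P z -> kall Q z -> kall (fun u => P u /\ Q u) z.
Proof.
elim: k z => [//|k' IHk] [a c] /= [Pa Pc] [Qa Qc].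
by split; [exact: IHk Pa Qa | exact: IHk Pc Qc].
Qed.

Lemma kall0 (P : E -> Prop) : P 0 -> kall P (0 : kos E k).
Proof. by move=> P0; elim: k. Qed.

Lemma kallD (P : E -> Prop) z w : (forall u v, P u -> P v -> P (u + v)) ->
  kall P z -> kall P w -> kall P (z + w).
Proof.
move=> PD; elim: k z w => [|k' IHk]; first exact: PD.
by move=> [a c] [a' c'] /= [? ?] [? ?]; split; apply: IHk.
Qed.

Lemma kallZ (P Q : E -> Prop) b z : (forall u, P u -> Q (b *: u)) ->
  kall P z -> kall Q (b *: z).
Proof.
move=> PZ; elim: k z => [|k' IHk]; first exact: PZ.
by move=> [a c] /= [? ?]; split; apply: IHk.
Qed.

Lemma kallN (P : E -> Prop) z : (forall u, P u -> P (- u)) ->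
  kall P z -> kall P (- z).
Proof. by rewrite -scaleN1r => PN; apply: kallZ => u; rewrite scaleN1r; exact: PN. Qed.

Lemma hdltD i z w : hdlt i z -> hdlt i w -> hdlt i (z + w).
Proof.
elim: k i z w => [|k' IHk] i; first by move=> z w zP wP /[dup] /zP-> /wP->; rewrite addr0.
by move=> [a c] [a' c'] /= [? ?] [? ?]; split; apply: IHk.
Qed.

Lemma hdltZ i b z : hdlt i z -> hdlt i (b *: z).
Proof.
elim: k i z => [|k' IHk] i; first by move=> z zP /zP->; rewrite scaler0.
by move=> [a c] /= [? ?]; split; apply: IHk.
Qed.

Lemma hdlt_0P z : hdlt 0 z -> z = 0.
Proof.
elim: k z => [|k' IHk]; first by move=> z; apply.
by move=> [a c] /= [/IHk-> /IHk->].
Qed.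

Lemma hdlt_full i z : (k < i)%N -> hdlt i z.
Proof.
elim: k i z => [|k' IHk] i z /= lt_ki; first by move=> i0; rewrite i0 in lt_ki.
by split; apply: IHk; [exact: ltnW | rewrite -ltnS (ltn_predK lt_ki)].
Qed.

End Chains.

Section Maps.
Variables (E F : lmodType R) (f : E -> F) (k : nat).

Lemma kall_kmap (P : E -> Prop) (Q : F -> Prop) (z : kos E k) :
  (forall u, P u -> Q (f u)) -> kall P z -> kall Q (kmap f z).
Proof.
move=> PQ; elim: k z => [|k' IHk] /=; first exact: PQ.
by case=> a c [/IHk ? /IHk ?].
Qed.

Lemma kmap_eq0 (z : kos E k) : kmap f z = 0 <-> kall (fun u => f u = 0) z.
Proof.
elim: k z => [//|k' IHk] [a c] /=; rewrite -!IHk.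
by split=> [[-> ->]|[-> ->]].
Qed.

Lemma kmapD (z w : kos E k) : {morph f : u v / u + v} ->
  kmap f (z + w) = kmap f z + kmap f w.
Proof.
move=> fD; elim: k z w => [|k' IHk] /=; first exact: fD.
by move=> [a c] [a' c'] /=; rewrite !IHk.
Qed.

(** Zero components are lifted to zero, which preserves the bound on the exterior degree. *)
Lemma kmap_lift (P : F -> Prop) (Q : E -> Prop) i (z : kos F k) :
    (forall u, P u -> exists2 v, Q v & f v = u) -> Q 0 -> f 0 = 0 ->
    kall P z -> hdlt i z ->
  exists y : kos E k, [/\ kall Q y, hdlt i y & kmap f y = z].
Proof.
move=> PQ Q0 f0; elim: k i z => [|k' IHk] i z /=.
  case: i => [|i] Pz zi; first by exists 0; split=> //=; rewrite zi.
  by have [y Qy fy] := PQ z Pz; exists y.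
case: z => a c /= [Pa Pc] [ia ic].
have [y [Qy iy <-]] := IHk i a Pa ia.
have [y' [Qy' iy' <-]] := IHk i.-1 c Pc ic.
by exists (y, y').
Qed.

End Maps.

Section Diff.
Variables (T : Type) (x : T -> R).

Lemma kdiff_linear (E : lmodType R) s : linear (@kdiff T x E s).
Proof.
elim: s => [|j s IHs] c u v /=; first by rewrite scaler0 addr0.
congr (_, _) => /=.
  by rewrite IHs !scalerDr !scalerA addrACA [x j * c]mulrC.
by rewrite IHs opprD scalerN.
Qed.

Section Rules.
Variables (E : lmodType R) (s : seq T).
Implicit Types z w : kos E (size s).

Lemma kdiffD z w : kdiff x (z + w) = kdiff x z + kdiff x w.
Proof. by move: (@kdiff_linear E s 1 z w); rewrite !scale1r. Qed.

Lemma kdiff_0 : kdiff x (0 : kos E (size s)) = 0.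
Proof. by apply: (addrI (kdiff x (0 : kos E (size s)))); rewrite -kdiffD !addr0. Qed.

Lemma kdiffZ c z : kdiff x (c *: z) = c *: kdiff x z.
Proof. by have := @kdiff_linear E s c z 0; rewrite addr0 kdiff_0 addr0. Qed.

Lemma kdiffN z : kdiff x (- z) = - kdiff x z.
Proof. by rewrite -scaleN1r kdiffZ scaleN1r. Qed.

Lemma kdiffB z w : kdiff x (z - w) = kdiff x z - kdiff x w.
Proof. by rewrite kdiffD kdiffN. Qed.

End Rules.

Lemma kdiffK (E : lmodType R) s (z : kos E (size s)) :
  kdiff x (kdiff x z) = 0.
Proof.
elim: s z => [//|j s IHs] [a c] /=.
rewrite kdiffD kdiffN kdiffZ !IHs scalerN add0r subrr !oppr0. congr pair.
Qed.

Lemma hdlt_kdiff (E : lmodType R) s i (z : kos E (size s)) :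
  hdlt i z -> hdlt i.-1 (kdiff x z).
Proof.
elim: s i z => [//|j s IHs] i [a c] /= [ia ic].
split; first by apply: hdltD; [exact: IHs | exact: hdltZ].
by rewrite -scaleN1r; apply/hdltZ/IHs.
Qed.

Lemma kall_kdiff (E : lmodType R) (P Q : E -> Prop) s (z : kos E (size s)) :
    Q 0 -> (forall u v, Q u -> Q v -> Q (u + v)) -> (forall u, Q u -> Q (- u)) ->
    (forall j u, P u -> Q (x j *: u)) ->
  kall P z -> kall Q (kdiff x z).
Proof.
move=> Q0 QD QN PQ; elim: s z => [//|j s IHs] [a c] /= [Pa Pc].
split; last by apply: kallN => //; exact: IHs.
apply: kallD => //; first exact: IHs.
exact: kallZ (PQ j) Pc.
Qed.

Lemma kfstD (E : lmodType R) k (z w : kos E k) : kfst (z + w) = kfst z + kfst w.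
Proof. by elim: k z w => [//|k IHk] z w /=; rewrite IHk. Qed.

Lemma kfstZ (E : lmodType R) k b (z : kos E k) : kfst (b *: z) = b *: kfst z.
Proof. by elim: k z => [//|k IHk] z /=; rewrite IHk. Qed.

Lemma kfst_base (E : lmodType R) k (u : E) : kfst (kbase k u) = u.
Proof. by elim: k. Qed.

Lemma kall_fst (E : lmodType R) k (P : E -> Prop) (z : kos E k) :
  kall P z -> P (kfst z).
Proof. by elim: k z => [//|k IHk] [a c] /= [/IHk]. Qed.

Lemma kall_base (E : lmodType R) k (P : E -> Prop) u :
  P 0 -> P u -> kall P (kbase k u).
Proof. by move=> P0 Pu; elim: k => //= k IHk; split; last exact: kall0. Qed.

Lemma kdiff_base (E : lmodType R) s (u : E) : kdiff x (kbase (size s) u) = 0.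
Proof.
elim: s => [//|j s IHs] /=.
by rewrite IHs kdiff_0 scaler0 addr0 oppr0; congr pair.
Qed.

(** In exterior degree 0 a boundary is a sum of terms x_j u, with u a component of [w]; through
    this, vanishing Koszul homology yields generators. *)
Lemma kfst_kdiff (E : lmodType R) (P Q : E -> Prop) s (w : kos E (size s)) :
    Q 0 -> (forall u v, Q u -> Q v -> Q (u + v)) ->
    (forall j u, P u -> Q (x j *: u)) ->
  kall P w -> Q (kfst (kdiff x w)).
Proof.
move=> Q0 QD PQ; elim: s w => [//|j s IHs] [a c] /= [Pa Pc].
rewrite kfstD kfstZ; apply: (QD); first exact: IHs.
by apply: PQ; apply: kall_fst Pc.
Qed.

End Diff.

Lemma kmap_scale (E F : lmodType R) (f g : E -> F) k b (z : kos E k) :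
  (forall u, f (b *: u) = g u) -> kmap f (b *: z) = kmap g z.
Proof.
move=> fg; elim: k z => [|k IHk] /=; first exact: fg.
by move=> [a c] /=; rewrite !IHk.
Qed.

Lemma scale_kmap (E F : lmodType R) (f g : E -> F) k b (z : kos E k) :
  (forall u, b *: f u = g u) -> b *: kmap f z = kmap g z.
Proof.
move=> fg; elim: k z => [|k IHk] /=; first exact: fg.
by move=> [a c] /=; rewrite -!IHk.
Qed.

Lemma kmap_add (E F : lmodType R) (f g h : E -> F) k (z : kos E k) :
  (forall u, f u + g u = h u) -> kmap f z + kmap g z = kmap h z.
Proof.
move=> fg; elim: k z => [|k IHk] /=; first exact: fg.
by move=> [a c] /=; rewrite -!IHk.
Qed.

Lemma kmap_id (E : lmodType R) k (z : kos E k) : kmap id z = z.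
Proof. by elim: k z => [//|k IHk] [a c] /=; rewrite !IHk. Qed.

Lemma kmap_cst0 (E F : lmodType R) k (z : kos E k) :
  kmap (fun=> 0 : F) z = 0.
Proof. by elim: k z => [//|k IHk] [a c] /=; rewrite !IHk. Qed.

Lemma kmapZ (E F : lmodType R) (f : E -> F) k b (z : kos E k) :
  (forall u, f (b *: u) = b *: f u) -> kmap f (b *: z) = b *: kmap f z.
Proof. by move=> fZ; rewrite (kmap_scale _ fZ); apply/esym/scale_kmap. Qed.

(** Only compatibility with the scalars of [s] is asked of f, so that it applies to division by a
    variable outside [s], which is not linear. *)
Lemma kmap_kdiff (T : eqType) (x : T -> R) (E F : lmodType R) (f : E -> F) s
    (z : kos E (size s)) :
    {morph f : u v / u + v} ->
    (forall j, j \in s -> forall u, f (x j *: u) = x j *: f u) ->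
  kmap f (kdiff x z) = kdiff x (kmap f z).
Proof.
move=> fD; have f0 : f 0 = 0.
  by apply: (addrI (f 0)); rewrite -fD !addr0.
have fN u : f (- u) = - f u.
  by apply/eqP; rewrite -addr_eq0 -fD addNr f0.
elim: s z => [|j s IHs] z fx /=; first exact: f0.
have IH := IHs _ (fun i si => fx i (@mem_behead _ (j :: s) i si)).
rewrite kmapD // IH kmapZ; last by apply: fx; rewrite mem_head.
by rewrite -!scaleN1r kmapZ ?IH // => u; rewrite !scaleN1r fN.
Qed.

End Koszul.

(** * Division of polynomials by a variable *)

Section Monomials.
Variables (K : fieldType) (m : nat).
Local Notation R := {mpoly K[m]}.
Implicit Types (f g : R) (a b : 'X_{1..m}).

Lemma mnm_neq0 a : a != 0%MM -> exists i, a i != 0%N.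
Proof. by rewrite -mdeg_eq0 mdegE sum_nat_eq0 negb_forall => /existsP. Qed.

Lemma mcoeffMXE f a b :
  (f * 'X_[b])@_a = if (b <= a)%MM then f@_(a - b) else 0.
Proof.
case: ifP => [ba|/negbT ba]; first by rewrite -{1}(submK ba) addmC mcoeffMX.
rewrite [f]mpolyE mulr_suml raddf_sum /= big1 // => c _.
rewrite -scalerAl -mpolyXD mcoeffZ mcoeffX; case: eqP => [cb|]; last by rewrite mulr0.
by rewrite -cb lem_addl in ba.
Qed.

Lemma mcoeffXM (i : 'I_m) f a :
  ('X_i * f)@_a = if a i == 0%N then 0 else f@_(a - U_(i)).
Proof. by rewrite mulrC mcoeffMXE lep1mP; case: eqP. Qed.

(* The values of [E] in degrees at least [N] are ignored. *)
Definition mpoly_of (N : nat) (E : 'X_{1..m} -> K) : R :=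
  \sum_(a : 'X_{1..m < N}) E a *: 'X_[a].

Lemma mcoeff_mpoly_of N E a :
  (forall b, (N <= mdeg b)%N -> E b = 0) -> (mpoly_of N E)@_a = E a.
Proof.
move=> E0; have [lt_aN|le_Na] := ltnP (mdeg a) N; first exact: mcoeff_mpoly.
rewrite E0 // raddf_sum /= big1 // => b _; rewrite mcoeffZ mcoeffX.
case: eqP => [ba|]; last by rewrite mulr0.
by move: (bmdeg b); rewrite ba ltnNge le_Na.
Qed.

Lemma mcoeff_msize f a : (msize f <= mdeg a)%N -> f@_a = 0.
Proof. by move=> le_fa; apply/memN_msupp_eq0/msize_mdeg_ge. Qed.

(** The quotient of f by X_i, with remainder [setX0 i f], the part of f free of X_i; see
    [mulXdivX]. *)
Definition divX (i : 'I_m) f : R := mpoly_of (msize f) (fun a => f@_(a + U_(i))).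

Definition setX0 (i : 'I_m) f : R :=
  mpoly_of (msize f) (fun a => if a i == 0%N then f@_a else 0).

Lemma mcoeff_divX i f a : (divX i f)@_a = f@_(a + U_(i)).
Proof.
by apply: mcoeff_mpoly_of => b le_fb; apply: mcoeff_msize; rewrite mdegD ltnW ?ltnS // mdeg1 addn1.
Qed.

Lemma mcoeff_setX0 i f a : (setX0 i f)@_a = if a i == 0%N then f@_a else 0.
Proof.
by apply: mcoeff_mpoly_of => b le_fb; rewrite mcoeff_msize ?if_same.
Qed.

Lemma divXXK i f : divX i ('X_i * f) = f.
Proof.
by apply/mpolyP => a; rewrite mcoeff_divX mcoeffXM mnmDE mnm1E eqxx addn1 addmK.
Qed.

Lemma divX_comm i j f : i != j -> divX i ('X_j * f) = 'X_j * divX i f.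
Proof.
move=> ij; apply/mpolyP => a; rewrite mcoeff_divX !mcoeffXM mnmDE mnm1E (negPf ij) addn0.
rewrite mcoeff_divX; case: eqP => // /eqP aj; congr (_ @__).
by rewrite [RHS]addmC addmBA ?lep1mP // addmC.
Qed.

Lemma setX0_comm i j f : i != j -> setX0 i ('X_j * f) = 'X_j * setX0 i f.
Proof.
move=> ij; apply/mpolyP => a; rewrite mcoeff_setX0 !mcoeffXM mcoeff_setX0.
by rewrite mnmBE mnm1E [j == i]eq_sym (negPf ij) subn0; case: eqP => //; case: eqP.
Qed.

Lemma setX0X i f : setX0 i ('X_i * f) = 0.
Proof.
by apply/mpolyP => a; rewrite mcoeff_setX0 mcoeffXM mcoeff0; case: eqP.
Qed.

Lemma mulXdivX i f : 'X_i * divX i f = f - setX0 i f.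
Proof.
apply/mpolyP => a; rewrite mcoeffXM mcoeffB mcoeff_setX0 mcoeff_divX.
case: eqP => [|/eqP ai]; first by rewrite subrr.
by rewrite subr0 submK // lep1mP.
Qed.

Lemma divXD i : {morph divX i : f g / f + g}.
Proof. by move=> f g; apply/mpolyP => a; rewrite !(mcoeff_divX, mcoeffD). Qed.

Lemma setX0D i : {morph setX0 i : f g / f + g}.
Proof.
move=> f g; apply/mpolyP => a; rewrite !(mcoeff_setX0, mcoeffD).
by case: eqP => //; rewrite addr0.
Qed.

End Monomials.

(** * Acyclicity of the Koszul complexes of free modules *)

Section FreeModules.
Variables (K : fieldType) (m : nat).
Local Notation R := {mpoly K[m]}.

(* Homogeneous elements of degree [e] in R(-c)^r *)
Definition homg r (c e : int) (v : 'rV[R]_r) : Prop :=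
  @free_piece K m r (fun=> c) e v.

Lemma homgE r c e (v : 'rV[R]_r) :
  homg c e v <-> forall l a, (mdeg a)%:Z + c != e -> (v 0 l)@_a = 0.
Proof.
split=> [vh l a|vh l a]; last first.
  by rewrite mcoeff_msupp => /eqP; case: (eqVneq ((mdeg a)%:Z + c) e) => // /vh ->.
by move=> ne; apply: memN_msupp_eq0; apply: contra ne => /vh /eqP.
Qed.

Section Rules.
Variables (r : nat) (c : int).
Implicit Types (u v : 'rV[R]_r).

Lemma homg0 e : homg c e (0 : 'rV[R]_r).
Proof. by apply/homgE => l a _; rewrite mxE mcoeff0. Qed.

Lemma homgD e u v : homg c e u -> homg c e v -> homg c e (u + v).
Proof.
move=> /homgE hu /homgE hv; apply/homgE => l a ne.
by rewrite mxE mcoeffD hu ?hv ?addr0.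
Qed.

Lemma homgN e u : homg c e u -> homg c e (- u).
Proof. by move=> /homgE hu; apply/homgE => l a ne; rewrite mxE mcoeffN hu ?oppr0. Qed.

Lemma homgZ e b u : homg c e u -> homg c e (b%:MP *: u).
Proof. by move=> /homgE hu; apply/homgE => l a ne; rewrite mxE mcoeffCM hu ?mulr0. Qed.

Lemma homgX e i u : homg c e u -> homg c (e + 1) ('X_i *: u).
Proof.
move=> /homgE hu; apply/homgE => l a ne; rewrite mxE mcoeffXM.
case: eqP => // /eqP ai; apply: hu; apply: contra ne => /eqP <-.
have Ua : (U_(i) <= a)%MM by rewrite lep1mP.
by rewrite -{1}(submK Ua) mdegD mdeg1 PoszD addrAC.
Qed.

Lemma homg_lt e u : (e < c)%R -> homg c e u -> u = 0.
Proof.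
move=> lt_ec /homgE hu; apply/rowP => l; apply/mpolyP => a; rewrite mxE mcoeff0.
by apply: hu; apply: contraTneq lt_ec => <-; rewrite -leNgt lerDr.
Qed.

End Rules.

(** The entries of v are polynomials in the variables of [s] alone, hence constants once [s] is
    empty. *)
Definition cst_free (s : seq 'I_m) r (v : 'rV[R]_r) : Prop :=
  forall l (a : 'X_{1..m}) i, i \notin s -> a i != 0%N -> (v 0 l)@_a = 0.

Local Notation kd := (kdiff (fun i : 'I_m => 'X_i : R)).

(* Division by X_j is a homotopy from the identity of the cone on X_j to the  *)
(* substitution X_j := 0, so the variables can be removed one at a time until *)
(* only constants remain, which have degree [c].                              *)
Lemma free_acyclic_seq r (c e : int) (s : seq 'I_m)
    (z : kos 'rV[R]_r (size s)) :
    uniq s -> e != c ->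
    kall (homg c e) z -> kall (@cst_free s r) z -> kd z = 0 ->
  exists2 w, kall (homg c (e - 1)) w & kd w = z.
Proof.
elim: s z => [|j s IHs] z /=.
  move=> _ ne zh zc _; exists 0; first exact: homg0.
  apply/esym/rowP => l; apply/mpolyP => a; rewrite mxE mcoeff0.
  have [->|] := eqVneq a 0%MM.
    by move/homgE: zh; apply; rewrite mdeg0 add0r eq_sym.
  move=> /mnm_neq0[i ai]; exact: (zc l a i).
case: z => a b /= /andP[js us] ne [ah bh] [ac bc] [/eqP].
rewrite addr_eq0 => /eqP da /eqP; rewrite oppr_eq0 => /eqP db.
have sj i : i \in s -> j != i by apply: contraTneq => <-.
pose sg := @map_mx R R (divX j) 1 r; pose ep := @map_mx R R (setX0 j) 1 r.
have sgD : {morph sg : u v / u + v} by move=> u v; apply/rowP=> l; rewrite !mxE divXD.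
have epD : {morph ep : u v / u + v} by move=> u v; apply/rowP=> l; rewrite !mxE setX0D.
have sgX i : i \in s -> forall u, sg ('X_i *: u) = 'X_i *: sg u.
  by move=> /sj ji u; apply/rowP=> l; rewrite !mxE divX_comm.
have epX i : i \in s -> forall u, ep ('X_i *: u) = 'X_i *: ep u.
  by move=> /sj ji u; apply/rowP=> l; rewrite !mxE setX0_comm.
have dsg : kd (kmap sg a) = - b.
  rewrite -kmap_kdiff // da -scalerN (kmap_scale (g := id)) ?kmap_id //.
  by move=> u; apply/rowP=> l; rewrite !mxE divXXK.
have dep : kd (kmap ep a) = 0.
  rewrite -kmap_kdiff // da -scalerN (kmap_scale (g := fun=> 0)) ?kmap_cst0 //.
  by move=> u; apply/rowP=> l; rewrite !mxE setX0X.
have sgh : kall (homg c (e - 1)) (kmap sg a).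
  apply: kall_kmap ah => u /homgE hu; apply/homgE => l x ne'; rewrite mxE mcoeff_divX.
  by apply: hu; apply: contra ne' => /eqP <-; rewrite mdegD mdeg1 PoszD addrAC addrK.
have eph : kall (homg c e) (kmap ep a).
  apply: kall_kmap ah => u /homgE hu; apply/homgE => l x ne'; rewrite mxE mcoeff_setX0.
  by rewrite hu ?if_same.
have epc : kall (@cst_free s r) (kmap ep a).
  apply: kall_kmap ac => u cu l x i is' xi; rewrite mxE mcoeff_setX0.
  case: eqP => // xj; apply: (cu l x i) => //; rewrite inE negb_or is' andbT.
  by apply: contraNneq xi => ->; rewrite xj.
have [w wh dw] := IHs (kmap ep a) us ne eph epc dep.
(* The first component of the boundary is [ep a] plus X_j times [sg a], which is a by division with
   remainder; the second is b by [dsg]. *)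
exists (w, kmap sg a) => //=; rewrite dw dsg opprK; congr pair.
rewrite (scale_kmap (g := fun u => 'X_j *: sg u)) //.
rewrite (kmap_add (h := id)) ?kmap_id // => u.
by apply/rowP=> l; rewrite !mxE mulXdivX addrC subrK.
Qed.

Lemma free_acyclic r (c e : int) (z : kos 'rV[R]_r (size (enum 'I_m))) :
  e != c -> kall (homg c e) z -> kd z = 0 ->
  exists2 w, kall (homg c (e - 1)) w & kd w = z.
Proof.
move=> ne zh; apply: free_acyclic_seq (enum_uniq _) ne zh _.
elim: (size _) z => [|k IHk] /= => [z l a i|[z w] /=]; first by rewrite mem_enum.
by split; apply: IHk.
Qed.

End FreeModules.

(** * From linear resolutions to Koszul homology *)

Section LinearResolutions.
Variables (K : fieldType) (m : nat).
Local Notation R := {mpoly K[m]}.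
Local Notation kd := (kdiff (fun i : 'I_m => 'X_i : R)).
Local Notation kosR E := (kos E (size (enum 'I_m))).

(** The bound i on the exterior degree of the cycles is what the induction along a resolution
    decreases. *)
Definition kexact (E : lmodType R) (P Q : E -> Prop) (i : nat) : Prop :=
  forall z : kosR E, kall P z -> hdlt i z -> kd z = 0 ->
  exists2 w, kall Q w & kd w = z.

(* Vanishing of the Koszul homology off the linear strand: since [kd] raises  *)
(* the internal degree by one and lowers the exterior degree by one, cycles   *)
(* may be taken with all components in the same degree [e].                   *)
Definition klinear (E : lmodType R) (P : int -> E -> Prop) (d : int) : Prop :=
  forall e, e != d -> forall z : kosR E, kall (P e) z -> kd z = 0 ->
  exists2 w, kall (P (e - 1)) w & kd w = z.

Definition ker_homg r (c : int) (E : lmodType R) (D : 'rV[R]_r -> E) (e : int)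
    (v : 'rV[R]_r) : Prop := homg c e v /\ D v = 0.

Lemma kd_kmap (E F : lmodType R) (D : {linear E -> F}) (z : kosR E) :
  kmap D (kd z) = kd (kmap D z).
Proof.
by apply: kmap_kdiff => [u v|i _ u]; [exact: linearD | exact: linearZ].
Qed.

Lemma kall_homg_kd r c e (y : kosR 'rV[R]_r) :
  kall (homg c e) y -> kall (homg c (e + 1)) (kd y).
Proof.
apply: kall_kdiff; first exact: homg0.
- exact: homgD.
- exact: homgN.
- by move=> i u; apply: homgX.
Qed.

(** The connecting map of 0 -> ker D -> R(-c)^r -> E -> 0 is injective on homology off degree c, as
    the free module is acyclic there. It lowers the exterior degree by one, whence i, and the
    differential raises the internal degree, whence e + 1. *)
Lemma kexact_quot r (c e : int) (E : lmodType R) (D : {linear 'rV[R]_r -> E})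
    (P Q : E -> Prop) i :
    e != c -> (forall u, P u -> exists2 v, homg c e v & D v = u) ->
    (forall v, homg c (e - 1) v -> Q (D v)) ->
    kexact (ker_homg c D (e + 1)) (ker_homg c D e) i ->
  kexact P Q i.+1.
Proof.
move=> ne lift DQ exi z Pz iz dz.
have [y [hy iy Dy]] := kmap_lift lift (homg0 _ _) (linear0 D) Pz iz.
have Ddy : kall (fun u => D u = 0) (kd y).
  by apply/kmap_eq0; rewrite kd_kmap Dy.
have [] := exi (kd y).
- by apply: kall_and => //; apply: kall_homg_kd.
- exact: hdlt_kdiff iy.
- exact: kdiffK.
move=> u uk du.
have [||w hw dw] := free_acyclic (z := y - u) ne.
- apply: kallD => //; first exact: homgD.
  by apply: kallN; [exact: homgN | apply: kall_mono uk => ? []].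
- by rewrite kdiffB du subrr.
exists (kmap D w); first by apply: kall_kmap hw.
rewrite -kd_kmap dw kmapD; last exact: linearD.
rewrite Dy; suff -> : kmap D (- u) = 0 by rewrite addr0.
apply/kmap_eq0; apply: kallN; first by move=> v Dv; rewrite linearN Dv oppr0.
by apply: kall_mono uk => ? [].
Qed.

(** The same long exact sequence, read for the kernel: z bounds some y in the free module, and y is
    corrected by the boundary of a lift of a chain bounding D y. Acyclicity of the free module needs
    e != c, that of E in degree e - 1 needs e != c + 1. *)
Lemma klinear_ker r (c e : int) (E : lmodType R) (D : {linear 'rV[R]_r -> E})
    (P : int -> E -> Prop) (z : kosR 'rV[R]_r) :
    e != c -> e != c + 1 ->
    (forall u, P (e - 1 - 1) u -> exists2 v, homg c (e - 1 - 1) v & D v = u) ->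
    (forall v, homg c (e - 1) v -> P (e - 1) (D v)) -> klinear P c ->
    kall (ker_homg c D e) z -> kd z = 0 ->
  exists2 w, kall (ker_homg c D (e - 1)) w & kd w = z.
Proof.
move=> ne ne1 lift DP linP kz dz.
have hz : kall (homg c e) z by apply: kall_mono kz => ? [].
have Dz : kmap D z = 0 by apply/kmap_eq0; apply: kall_mono kz => ? [].
have [y hy dy] := free_acyclic ne hz dz.
have ne' : e - 1 != c by apply: contra ne1 => /eqP <-; rewrite subrK.
have [||w Pw dw] := linP _ ne' (kmap D y).
- exact: kall_kmap hy.
- by rewrite -kd_kmap dy.
have [v [hv _ Dv]] := kmap_lift lift (homg0 _ _) (linear0 D) Pw (hdlt_full w (ltnSn _)).
have hdv : kall (homg c (e - 1)) (kd v) by rewrite -{1}[e - 1](subrK 1); apply: kall_homg_kd.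
exists (y - kd v); last by rewrite kdiffB kdiffK subr0.
apply: kall_and; first by apply: kallD => //; [exact: homgD | exact: kallN (@homgN _ _ _ _ _) _].
apply/kmap_eq0; rewrite kmapD; last exact: linearD.
by rewrite -scaleN1r kmapZ ?kd_kmap ?Dv ?dw ?scaleN1r ?subrr // => u; rewrite linearZ.
Qed.

(** [gr_comp] expresses directness of the sum of the pieces without projections. The consecutive
    degrees c + q are those of the images of the components of an element of R(-c)^r. *)
Record grading (E : lmodType R) (P : int -> E -> Prop) : Prop := {
  gr0 : forall e, P e 0;
  grD : forall e u v, P e u -> P e v -> P e (u + v);
  grN : forall e u, P e u -> P e (- u);
  grZ : forall e b u, P e u -> P e (b%:MP *: u);
  grX : forall e i u, P e u -> P (e + 1) ('X_i *: u);
  gr_comp : forall N (c e : int) (g : nat -> E) u,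
    (forall q : nat, P (c + q%:Z) (g q)) -> P e u -> \sum_(q < N) g q = u ->
    (forall q, (q < N)%N -> g q = if c + q%:Z == e then u else 0) /\
    ((forall q, (q < N)%N -> c + q%:Z != e) -> u = 0)
}.

(** The [psi i] are coordinates that separate elements, and [psi i] sees only degree [deg i]; so
    [gr_comp] can be checked in each coordinate, where at most one summand survives. *)
Lemma grading_of (I : Type) (W : zmodType) (deg : I -> int)
    (E : lmodType R) (psi : I -> E -> W) (P : int -> E -> Prop) :
    (forall i, {morph psi i : u v / u + v}) ->
    (forall u, (forall i, psi i u = 0) -> u = 0) ->
    (forall e u, P e u <-> forall i, deg i != e -> psi i u = 0) ->
    (forall e b u, P e u -> P e (b%:MP *: u)) ->
    (forall e i u, P e u -> P (e + 1) ('X_i *: u)) ->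
  grading P.
Proof.
move=> psiD inj PE PZ PX.
have psi0 i : psi i 0 = 0 by apply: (addrI (psi i 0)); rewrite -psiD !addr0.
have psiN i u : psi i (- u) = - psi i u.
  by apply/eqP; rewrite -addr_eq0 -psiD addNr psi0.
split=> //.
- by move=> e; apply/PE => i _.
- by move=> e u v /PE hu /PE hv; apply/PE => i ne; rewrite psiD hu ?hv ?addr0.
- by move=> e u /PE hu; apply/PE => i ne; rewrite psiN hu ?oppr0.
move=> N c e g u Pg /PE Pu su.
have psis i : psi i u = \sum_(q < N) psi i (g q).
  by rewrite -su; apply: (big_morph (psi i)).
have psig i q : deg i != c + q%:Z -> psi i (g q) = 0 by move/(PE _ _).1: (Pg q); apply.
have psiu i q : (q < N)%N -> deg i = c + q%:Z -> psi i u = psi i (g q).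
  move=> lt_qN di; rewrite psis (bigD1 (Ordinal lt_qN)) //= big1 ?addr0 // => p ne.
  by apply: psig; rewrite di (inj_eq (addrI c)) eqz_nat eq_sym.
split=> [q lt_qN|ne].
  case: eqP => [ce|/eqP ce]; last first.
    apply: inj => i; have [di|] := eqVneq (deg i) (c + q%:Z); last exact: psig.
    by rewrite -psiu // Pu // di.
  apply/eqP; rewrite -subr_eq0; apply/eqP/inj => i; rewrite psiD psiN.
  have [di|ne] := eqVneq (deg i) (c + q%:Z); first by rewrite -psiu // subrr.
  by rewrite psig // Pu ?subrr // -ce.
apply: inj => i; have [de|] := eqVneq (deg i) e; last exact: Pu.
by rewrite psis big1 // => q _; rewrite psig // de eq_sym ne.
Qed.

Lemma homg_grading r (c : int) : grading (@homg K m r c).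
Proof.
apply: (@grading_of ('I_r * 'X_{1..m})%type (K : zmodType)
  (fun p => (mdeg p.2)%:Z + c) 'rV[R]_r (fun p v => (v 0 p.1)@_(p.2))).
- by move=> i u v; rewrite mxE mcoeffD.
- by move=> u u0; apply/rowP => l; apply/mpolyP => a; rewrite (u0 (l, a)) mxE mcoeff0.
- by move=> e u; rewrite homgE; split=> [h [l a]|h l a]; [exact: h | exact: (h (l, a))].
- by move=> e b u; apply: homgZ.
- by move=> e i u; apply: homgX.
Qed.

Definition hcomp r (q : nat) (v : 'rV[R]_r) : 'rV[R]_r :=
  map_mx (pihomog mdeg q) v.

Lemma homg_hcomp r c q (v : 'rV[R]_r) : homg c (c + q%:Z) (hcomp q v).
Proof.
move=> l a; rewrite mxE => ha; rewrite addrC; congr (_ + Posz _).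
by have /dhomogP/(_ _ ha) := pihomogP mdeg q (v 0 l).
Qed.

Lemma sum_hcomp r (v : 'rV[R]_r) :
  exists N, forall N', (N <= N')%N -> v = \sum_(q < N') hcomp q v.
Proof.
exists (\max_(l < r) msize (v ord0 l))%N => N' le_N; apply/rowP => l; rewrite summxE.
under eq_bigr do rewrite mxE.
by apply/pihomog_partitionE/(leq_trans _ le_N)/(leq_bigmax (F := fun l => msize (v ord0 l))).
Qed.

Section GradedMap.
Variables (r : nat) (c : int) (E : lmodType R) (P : int -> E -> Prop).
Variables (D : {linear 'rV[R]_r -> E}).
Hypotheses (grP : grading P) (DP : forall e v, homg c e v -> P e (D v)).

(** The lift is the component of v in degree e, or 0 if no component of v has that degree, in which
    case D v = 0. *)
Lemma graded_lift e v : P e (D v) -> exists2 w, homg c e w & D w = D v.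
Proof.
move=> Pv; have [N vE] := sum_hcomp v.
have Ph q : P (c + q%:Z) (D (hcomp q v)) by apply/DP/homg_hcomp.
have [] := gr_comp grP (N := N) (u := D v) Ph Pv; first by rewrite -linear_sum -vE.
move=> hq h0; have [/existsP[q /eqP cq]|] := boolP [exists q : 'I_N, c + q%:Z == e].
  by exists (hcomp q v); [rewrite -cq; exact: homg_hcomp | rewrite hq ?ltn_ord // cq eqxx].
move/existsPn => h; exists 0; first exact: homg0.
by rewrite linear0 h0 // => q lt_qN; exact: (h (Ordinal lt_qN)).
Qed.

Lemma graded_ker v q : D v = 0 -> D (hcomp q v) = 0.
Proof.
move=> Dv; have [N vE] := sum_hcomp v.
have Ph p : P (c + p%:Z) (D (hcomp p v)) by apply/DP/homg_hcomp.
have [] := gr_comp grP (N := maxn N q.+1) (u := 0) Ph (gr0 grP 0).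
  by rewrite -linear_sum -vE ?leq_maxl.
by move=> /(_ q); rewrite leq_maxr if_same => ->.
Qed.

(** Elements split into finitely many homogeneous components, so exactness in each degree is
    enough. *)
Lemma exact_by_pieces r' c' (D' : {linear 'rV[R]_r' -> 'rV[R]_r}) :
    (forall e v, homg c' e v -> ker_homg c D e (D' v)) ->
    (forall e v, ker_homg c D e v -> exists2 u, homg c' e u & D' u = v) ->
  forall v, D v = 0 <-> exists u, v = D' u.
Proof.
move=> sub lift v; split=> [Dv|[u ->]]; last first.
  have [N uE] := sum_hcomp u; rewrite (uE N) // !linear_sum big1 // => q _.
  by have [] := sub _ _ (@homg_hcomp _ c' q u).
have [N vE] := sum_hcomp v.
have /choice[f fE] (q : nat) : exists u, D' u = hcomp q v.
  have [|u _ <-] := lift (c + q%:Z) (hcomp q v); last by exists u.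
  by split; [exact: homg_hcomp | exact: graded_ker].
exists (\sum_(q < N) f q); rewrite linear_sum {1}(vE N) //.
by apply: eq_bigr => q _; rewrite fE.
Qed.

End GradedMap.

End LinearResolutions.

Section ResolutionToKoszul.
Variables (K : fieldType) (m : nat).
Local Notation R := {mpoly K[m]}.
Variables (d : int) (N : lmodType R) (piece : int -> N -> Prop).
Hypothesis gr : grading piece.
Variable F : min_graded_res piece.
Hypothesis F_linear :
  forall (j : nat) (k : int), k != d + j%:Z -> graded_betti F j k = 0%N.

Lemma res_shift_linear j l : @res_shift _ _ _ _ F j l = d + j%:Z.
Proof.
apply/eqP; apply: contraT => /F_linear; rewrite /graded_betti => /eqP.
by rewrite cards_eq0 => /eqP/setP/(_ l); rewrite !inE eqxx.
Qed.

Lemma free_piece_linear j e v :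
  free_piece (@res_shift _ _ _ _ F j) e v <-> @homg K m _ (d + j%:Z) e v.
Proof.
by split=> h l a /h; rewrite res_shift_linear.
Qed.

Let D j : {linear 'rV[R]_(res_rank F j.+1) -> 'rV[R]_(res_rank F j)} :=
  mulmxr (res_diff F j).

Lemma res_diff_hom j e v :
  homg (d + j.+1%:Z) e v -> homg (d + j%:Z) e (D j v).
Proof. by move=> /free_piece_linear/res_diff_graded/free_piece_linear. Qed.

(** The kernel of [D j] is the image of F_{j+2}, which is generated in degree d + j + 2. Each use of
    [kexact_quot] passes to the next kernel and lowers i, until the bound 0 leaves only the zero
    chain. *)
Lemma ker_diff_kexact i j e : e != d + j.+2%:Z ->
  kexact (ker_homg (d + j.+1%:Z) (D j) e) (ker_homg (d + j.+1%:Z) (D j) (e - 1)) i.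
Proof.
elim: i j e => [|i IHi] j e ne.
  move=> z _ /hdlt_0P-> _; exists 0; last exact: kdiff_0.
  by apply: kall0; split; [exact: homg0 | exact: linear0].
have lift e' v : ker_homg (d + j.+1%:Z) (D j) e' v ->
    exists2 u, homg (d + j.+2%:Z) e' u & D j.+1 u = v.
  case=> hv /res_exactS[u vE]; rewrite vE.
  apply: (graded_lift (@homg_grading K m _ (d + j.+1%:Z)) (@res_diff_hom j.+1)).
  by rewrite /= -vE.
have sub e' v : homg (d + j.+2%:Z) e' v -> ker_homg (d + j.+1%:Z) (D j) e' (D j.+1 v).
  move=> hv; split; first exact: res_diff_hom.
  by apply/res_exactS; exists v.
apply: (kexact_quot ne (lift e) (sub (e - 1))).
by rewrite -{2}[e](addrK 1); apply: IHi; lia.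
Qed.

Lemma linear_resolution_klinear : klinear piece d.
Proof.
move=> e ne z Pz dz.
have augP e' v : homg (d + 0) e' v -> piece e' (res_aug F v).
  by move=> /free_piece_linear/res_aug_graded.
have lift e' u : piece e' u -> exists2 v, homg (d + 0) e' v & res_aug F v = u.
  have [v <-] := res_aug_surj F u; exact: graded_lift.
have lift0 e' v : ker_homg (d + 0) (res_aug F) e' v ->
    exists2 u, homg (d + 1) e' u & D 0 u = v.
  case=> hv /res_exact0[u vE]; rewrite vE.
  apply: (graded_lift (@homg_grading K m _ (d + 0)) (@res_diff_hom 0)).
  by rewrite /= -vE.
have sub e' v : homg (d + 1) e' v -> ker_homg (d + 0) (res_aug F) e' (D 0 v).
  move=> hv; split; first exact: res_diff_hom.
  by apply/res_exact0; exists v.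
have ne0 : e != d + 0 by rewrite addr0.
(* The bound is the number of variables plus 2, a successor for each of the two uses of
   [kexact_quot] here, on the augmentation and on [D 0]. *)
apply: (kexact_quot ne0 (lift e) (augP (e - 1)) _ Pz (hdlt_full z (ltnW (ltnSn _.+1))) dz).
have ne1 : e + 1 != d + 1 by rewrite (inj_eq (addIr 1)).
apply: (kexact_quot ne1 (lift0 _) _).
  by rewrite addrK => v; have := sub e v.
by rewrite -{2}[e + 1](addrK 1); apply: ker_diff_kexact; lia.
Qed.

End ResolutionToKoszul.

(** * From Koszul homology to linear resolutions *)

Section FiniteBasis.
Variables (K : fieldType) (m : nat) (E : lmodType {mpoly K[m]}).

Definition comb r (b : 'I_r -> E) (c : 'rV[K]_r) : E :=
  \sum_l (c 0 l)%:MP *: b l.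

(** The spanning elements h need not belong to Q. *)
Definition fin_dim (Q : E -> Prop) : Prop :=
  exists t (h : 'I_t -> E), forall u, Q u -> exists c, u = comb h c.

Lemma combZ r (b : 'I_r -> E) x c : comb b (x *: c) = x%:MP *: comb b c.
Proof.
by rewrite scaler_sumr; apply: eq_bigr => l _; rewrite mxE rmorphM scalerA.
Qed.

Lemma comb0 r (b : 'I_r -> E) : comb b 0 = 0.
Proof. by rewrite -(scale0r (0 : 'rV[K]_r)) combZ rmorph0 scale0r. Qed.

Lemma comb_mulmx r t (h : 'I_t -> E) (M : 'M[K]_(r, t)) (x : 'rV[K]_r) :
  comb (fun l => comb h (row l M)) x = comb h (x *m M).
Proof.
rewrite /comb; under eq_bigr do rewrite scaler_sumr.
rewrite exchange_big; apply: eq_bigr => i _ /=.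
rewrite mxE rmorph_sum scaler_suml; apply: eq_bigr => l _.
by rewrite scalerA mxE rmorphM.
Qed.

(** The size of an independent family in Q is at most t, so a largest one exists; it spans Q, since
    otherwise an element outside its span could be added. *)
Lemma basis_of_fin_dim (Q : E -> Prop) :
    Q 0 -> (forall u v, Q u -> Q v -> Q (u + v)) ->
    (forall x u, Q u -> Q (x%:MP *: u)) -> fin_dim Q ->
  exists r (b : 'I_r -> E), [/\ forall l, Q (b l),
    forall c, comb b c = 0 -> c = 0 & forall u, Q u -> exists c, u = comb b c].
Proof.
move=> Q0 QD QZ [t [h hQ]].
pose free_in r := exists b : 'I_r -> E,
  (forall l, Q (b l)) /\ (forall c, comb b c = 0 -> c = 0).
have free_le r : free_in r -> (r <= t)%N.
  case=> b [bQ bfree]; rewrite leqNgt; apply/negP => lt_tr.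
  have /choice[C CE] l : exists c, b l = comb h c by exact: hQ.
  pose M := \matrix_l C l.
  have /rowV0Pn[x /sub_kermxP xM] : kermx M != 0.
    by rewrite kermx_eq0 /row_free neq_ltn (leq_ltn_trans (rank_leq_col M)).
  suff /bfree -> : comb b x = 0 by rewrite eqxx.
  rewrite -(comb0 h) -xM -comb_mulmx.
  by apply: eq_bigr => l _; rewrite CE rowK.
have free0 : free_in 0%N by exists (fun=> 0); split=> // c _; rewrite thinmx0.
have [r /asboolP[b [bQ bfree]] rmax] :
    {r | `[< free_in r >] & forall s, `[< free_in s >] -> (s <= r)%N}.
  have ex : exists r, `[< free_in r >] by exists 0%N; apply/asboolP.
  have bd r : `[< free_in r >] -> (r <= t)%N by move/asboolP/free_le.
  by case: (ex_maxnP ex bd) => r Pr rmax; exists r.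
exists r, b; split=> // u Qu; apply: contrapT => nspan.
suff /asboolP/rmax : free_in r.+1 by rewrite ltnn.
exists (fun l => if unlift ord0 l is Some l' then b l' else u); split=> [l|c].
  by case: unliftP.
rewrite /comb big_ord_recl unlift_none.
under eq_bigr do rewrite liftK.
pose c' : 'rV[K]_r := \row_l c 0 (lift ord0 l).
rewrite (_ : \sum_(_ < _) _ = comb b c'); last first.
  by apply: eq_bigr => l _; rewrite mxE.
have [c0|c0 cu] := eqVneq (c 0 ord0) 0.
  rewrite c0 rmorph0 scale0r add0r => /bfree c'0.
  apply/rowP => l; rewrite mxE; case: (unliftP ord0 l) => [l'|] -> //.
  by have /rowP/(_ l') := c'0; rewrite !mxE.
case: nspan; exists (- (c 0 ord0)^-1 *: c').
move/eqP: cu; rewrite addrC addr_eq0 => /eqP cu.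
by rewrite combZ cu scalerN rmorphN scaleNr opprK scalerA -rmorphM mulVf // rmorph1 scale1r.
Qed.

End FiniteBasis.

Section KoszulToResolution.
Variables (K : fieldType) (m : nat).
Local Notation R := {mpoly K[m]}.

(** The invariant in the construction of the resolution, passed on to kernels with d + 1 for d.
    Boundedness below founds the induction on degrees in [linear_cover]; [lp_fin_dim] makes the
    cover finite. *)
Record linear_piece (E : lmodType R) (P : int -> E -> Prop) (d : int) : Prop := {
  lp0 : forall e, P e 0;
  lpD : forall e u v, P e u -> P e v -> P e (u + v);
  lpZ : forall e b u, P e u -> P e (b%:MP *: u);
  lpX : forall e i u, P e u -> P (e + 1) ('X_i *: u);
  lp_bounded : exists e0, forall e u, e < e0 -> P e u -> u = 0;
  lp_fin_dim : fin_dim (P d);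
  lp_klinear : klinear P d
}.

Lemma homg_fin_dim r (c e : int) : fin_dim (@homg K m r c e).
Proof.
(* Monomials of degree e in R(-c) have exponents of degree e - c; the absolute value serves as a
   bound in all cases. *)
pose N := `|e - c|.+1%N.
pose I := ('I_r * 'X_{1..m < N})%type.
pose h (p : I) : 'rV[R]_r := 'X_[p.2] *: delta_mx 0 p.1.
pose q (u : 'rV[R]_r) (p : I) := (u 0 p.1)@_p.2.
exists #|{: I}|, (fun i => h (enum_val i)) => u hu.
exists (\row_i q u (enum_val i)); rewrite /comb.
under eq_bigr do rewrite mxE.
rewrite -(big_enum_val (A := predT) (fun p => (q u p)%:MP *: h p)) /=.
have uN l : (msize (u ord0 l) <= N)%N.
  rewrite msizeE; apply/bigmax_leqP_seq => a au _; rewrite ltnS.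
  by have := hu l a au; lia.
rewrite -(pair_bigA _ (fun l (a : 'X_{1..m < N}) => (q u (l, a))%:MP *: h (l, a))) /=.
apply/rowP => l; rewrite summxE (bigD1 l) //= [X in _ + X]big1 => [|k ne].
  rewrite addr0 summxE {1}(mpolywE (uN l)); apply: eq_bigr => a _.
  by rewrite !mxE !eqxx mulr1 mul_mpolyC.
by rewrite summxE big1 // => a _; rewrite !mxE [l == k]eq_sym (negPf ne) andbF !mulr0.
Qed.

Section Cover.
Variables (E : lmodType R) (P : int -> E -> Prop) (d : int).
Hypothesis lp : linear_piece P d.

Lemma lpXm e a u : P e u -> P (e + (mdeg a)%:Z) ('X_[a] *: u).
Proof.
have [k] := ubnP (mdeg a); elim: k a => // k IHk a lt_ak Pu.
have [->|] := eqVneq a 0%MM; first by rewrite mdeg0 addr0 mpolyX0 scale1r.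
move=> /mnm_neq0[i ai].
have Ua : (U_(i) <= a)%MM by rewrite lep1mP.
have da : mdeg a = (mdeg (a - U_(i))).+1 by rewrite -{1}(submK Ua) mdegD mdeg1 addn1.
rewrite da -addn1 PoszD addrA -[in 'X_[_]](submK Ua) addmC mpolyXD -scalerA.
by apply/(lpX lp)/IHk => //; rewrite -ltnS -da.
Qed.

Definition lincomb r (b : 'I_r -> E) (v : 'rV[R]_r) : E := \sum_l v 0 l *: b l.

Lemma lincomb_linear r (b : 'I_r -> E) : linear (lincomb b).
Proof.
move=> c u v; rewrite /lincomb scaler_sumr -big_split; apply: eq_bigr => l _.
by rewrite !mxE scalerDl scalerA.
Qed.

HB.instance Definition _ r (b : 'I_r -> E) :=
  GRing.isLinear.Build R 'rV[R]_r E *:%R (lincomb b) (lincomb_linear b).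

Lemma lincomb_graded r (b : 'I_r -> E) e v :
  (forall l, P d (b l)) -> homg d e v -> P e (lincomb b v).
Proof.
move=> Pb hv; apply: (big_ind (P e)) => [|? ?|l _]; first exact: lp0 lp _.
  exact: lpD lp _ _ _.
rewrite [v 0 l]mpolyE scaler_suml big_seq.
apply: (big_ind (P e)) => [|? ?|a av]; first exact: lp0 lp _.
  exact: lpD lp _ _ _.
rewrite -mul_mpolyC -scalerA; apply: lpZ lp _ _ _ _.
by rewrite -(hv l a av) addrC; apply: lpXm.
Qed.

(** D sends the unit vectors to a basis of [P d]. Homology in exterior degree 0 makes it onto every
    piece, and [klinear_ker] gives linearity of the kernel except in degree d, where independence of
    the basis makes the kernel zero. *)
Lemma linear_cover : exists r (D : {linear 'rV[R]_r -> E}),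
  [/\ forall e v, homg d e v -> P e (D v),
      forall e u, P e u -> exists2 v, homg d e v & D v = u
    & linear_piece (ker_homg d D) (d + 1)].
Proof.
have [r [b [Pb bfree bspan]]] :=
  basis_of_fin_dim (lp0 lp d) (@lpD _ _ _ lp d) (@lpZ _ _ _ lp d) (lp_fin_dim lp).
pose D : {linear 'rV[R]_r -> E} := lincomb b.
have DP e v : homg d e v -> P e (D v) by apply: lincomb_graded.
have Dlift e u : P e u -> exists2 v, homg d e v & D v = u.
  have [e0 Pe0] := lp_bounded lp.
  have [k] : exists k, e < e0 + k%:Z by exists `|e - e0|.+1; lia.
  elim: k e u => [|k IHk] e u lt_ek Pu.
    rewrite addr0 in lt_ek; rewrite (Pe0 e u) //.
    by exists 0; [exact: homg0 | exact: linear0].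
  have [ed|ne] := eqVneq e d.
    rewrite ed in Pu *; have [c ->] := bspan u Pu.
    exists (\row_l (c 0 l)%:MP); last by apply: eq_bigr => l _; rewrite mxE.
    apply/homgE => l a ne; rewrite mxE mcoeffC; case: eqP => [a0|]; last by rewrite mulr0.
    by rewrite a0 mdeg0 add0r eqxx in ne.
  (* As a cycle of exterior degree 0, u is a boundary, hence a sum of terms x_i v with v in
     [P (e - 1)], to which the induction applies. *)
  have [||w Pw dw] := lp_klinear lp ne (z := kbase _ u).
  - by apply: kall_base => //; apply: lp0 lp _.
  - exact: kdiff_base.
  rewrite -(kfst_base (size (enum 'I_m)) u) -dw.
  apply: (kfst_kdiff (P := P (e - 1)) (Q := fun u => exists2 v, homg d e v & D v = u)) => //.
  - by exists 0; [exact: homg0 | exact: linear0].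
  - move=> _ _ [v hv <-] [v' hv' <-]; exists (v + v'); first exact: homgD.
    exact: linearD.
  - move=> i v /IHk[|v' hv' <-]; first by lia.
    by exists ('X_i *: v'); [rewrite -[e](subrK 1); exact: homgX | exact: linearZ].
(* In degree d the free module consists of constant vectors, on which D forms combinations of the
   independent family b. *)
have D0 v : homg d d v -> D v = 0 -> v = 0.
  move=> hv Dv; pose c : 'rV[K]_r := \row_l (v 0 l)@_0%MM.
  have vE : v = \row_l (c 0 l)%:MP.
    apply/rowP => l; apply/mpolyP => a; rewrite !mxE mcoeffC.
    case: eqP => [->|/eqP a0]; first by rewrite mulr1.
    rewrite mulr0; move/homgE: hv; apply.
    by rewrite -subr_eq0 addrK eqz_nat mdeg_eq0.
  have c0 : c = 0.
    by apply: bfree; rewrite -Dv {1}vE; apply: eq_bigr => l _; rewrite !mxE.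
  by rewrite vE c0; apply/rowP => l; rewrite !mxE rmorph0.
exists r, D; split=> //; split.
- by move=> e; split; [exact: homg0 | exact: linear0].
- by move=> e u v [hu Du] [hv Dv]; split; [exact: homgD | rewrite linearD Du Dv addr0].
- by move=> e x u [hu Du]; split; [exact: homgZ | rewrite linearZ /= Du scaler0].
- by move=> e i u [hu Du]; split; [exact: homgX | rewrite linearZ /= Du scaler0].
- by exists d => e u lt_ed [hu _]; exact: homg_lt hu.
- have [t [h hP]] := @homg_fin_dim r d (d + 1).
  by exists t, h => u [hu _]; exact: hP.
move=> e ne z kz dz; have [ed|ne'] := eqVneq e d; last first.
  apply: (klinear_ker ne' ne _ _ (lp_klinear lp) kz dz).
    exact: Dlift.
  exact: DP.
exists 0; first by apply: kall0; split; [exact: homg0 | exact: linear0].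
rewrite kdiff_0 -[z]kmap_id; apply/esym/kmap_eq0; apply: kall_mono kz => v [].
by rewrite ed; exact: D0.
Qed.

End Cover.
Section Iteration.
Variables (E : lmodType R) (P : int -> E -> Prop) (d : int).
Hypotheses (gr : grading P) (lp : linear_piece P d).
Hypothesis gen : forall u : E, exists2 s : seq E,
  (forall v, v \in s -> exists e, P e v) & u = \sum_(v <- s) v.

Definition cover_spec (F : lmodType R) (Q : int -> F -> Prop) c
    (p : {r & {linear 'rV[R]_r -> F}}) : Prop :=
  let D := projT2 p in
  [/\ forall e v, homg c e v -> Q e (D v),
      forall e u, Q e u -> exists2 v, homg c e v & D v = u
    & linear_piece (ker_homg c D) (c + 1)].

Definition cover (F : lmodType R) (Q : int -> F -> Prop) c
    (q : linear_piece Q c) : {p | cover_spec Q c p}.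
Proof.
apply: cid; have [r [D DP]] := linear_cover q.
by exists (existT _ r D).
Defined.

(** A syzygy module is kept as homogeneous pieces inside a free module and packed with its rank and
    degree, so that [iter] can produce all of them. *)
Record syzygy := Syzygy {
  syz_rank : nat;
  syz_deg : int;
  syz_piece : int -> 'rV[R]_syz_rank -> Prop;
  syzP : linear_piece syz_piece syz_deg
}.

Definition cover_map (F : lmodType R) (Q : int -> F -> Prop) c
    (q : linear_piece Q c) : {linear 'rV[R]_(projT1 (sval (cover q))) -> F} :=
  projT2 (sval (cover q)).

Lemma cover_mapP (F : lmodType R) (Q : int -> F -> Prop) c
    (q : linear_piece Q c) :
  [/\ forall e v, homg c e v -> Q e (cover_map q v),
      forall e u, Q e u -> exists2 v, homg c e v & cover_map q v = u
    & linear_piece (ker_homg c (cover_map q)) (c + 1)].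
Proof. exact: svalP (cover q). Qed.

Definition cover_syzygy (F : lmodType R) (Q : int -> F -> Prop) c
    (q : linear_piece Q c) : syzygy :=
  Syzygy (let: And3 _ _ h := cover_mapP q in h).

(** [syz j] lies in F_j and is linear in degree d + j + 1; its cover [syz_map j] is the differential
    from F_{j+1} to F_j. *)
Definition syz (j : nat) : syzygy :=
  iter j (fun q => cover_syzygy (syzP q)) (cover_syzygy lp).

Definition syz_map (j : nat) :
    {linear 'rV[R]_(syz_rank (syz j.+1)) -> 'rV[R]_(syz_rank (syz j))} :=
  cover_map (syzP (syz j)).

Lemma syz_degE j : syz_deg (syz j) = d + j.+1%:Z.
Proof. by elim: j => [//|j /= ->]; rewrite -addrA -PoszD addn1. Qed.

Lemma syz_pieceS j e v :
  syz_piece (s := syz j.+1) e v <-> ker_homg (d + j.+1%:Z) (syz_map j) e v.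
Proof. by rewrite -syz_degE. Qed.

Lemma syz_piece0 e v :
  syz_piece (s := syz 0) e v <-> ker_homg d (cover_map lp) e v.
Proof. by []. Qed.

Lemma syz_map_graded j e v : homg (d + j.+1%:Z) e v ->
  syz_piece (s := syz j) e (syz_map j v).
Proof.
by rewrite -syz_degE; case: (cover_mapP (syzP (syz j))) => h _ _; exact: h.
Qed.

Lemma syz_map_lift j e u : syz_piece (s := syz j) e u ->
  exists2 v, homg (d + j.+1%:Z) e v & syz_map j v = u.
Proof.
by rewrite -syz_degE; case: (cover_mapP (syzP (syz j))) => _ h _; exact: h.
Qed.

Lemma syz_piece_homg j e v : syz_piece (s := syz j) e v -> homg (d + j%:Z) e v.
Proof. by case: j v => [|j] v; [rewrite addr0 => -[] | move=> /syz_pieceS[]]. Qed.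

Lemma aug_graded e v : homg (d + 0) e v -> P e (cover_map lp v).
Proof. by rewrite addr0; case: (cover_mapP lp) => h _ _; exact: h. Qed.

Lemma aug_surj u : exists v, cover_map lp v = u.
Proof.
have [s Ps ->] := gen u; have [_ lift _] := cover_mapP lp.
elim: s Ps => [|v s IHs] Ps; first by exists 0; rewrite linear0 big_nil.
have [|w wE] := IHs; first by move=> x xs; apply: Ps; rewrite inE xs orbT.
have [e Pv] := Ps v (mem_head _ _); have [y _ yE] := lift e v Pv.
by exists (y + w); rewrite linearD yE wE big_cons.
Qed.

Lemma aug_exact v : cover_map lp v = 0 <-> exists u, v = syz_map 0 u.
Proof.
apply: (exact_by_pieces gr aug_graded (c' := d + 1)) => e w.
  by move=> /syz_map_graded/syz_piece0; rewrite addr0.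
by move=> h; apply: (@syz_map_lift 0 e w); rewrite addr0 in h.
Qed.

Lemma syz_exact j v : syz_map j v = 0 <-> exists u, v = syz_map j.+1 u.
Proof.
have gmap e w : homg (d + j.+1%:Z) e w -> homg (d + j%:Z) e (syz_map j w).
  by move=> hw; apply/syz_piece_homg/syz_map_graded.
apply: (exact_by_pieces (@homg_grading K m _ (d + j%:Z)) gmap (c' := d + j.+2%:Z)).
- by move=> e w hw; apply/syz_pieceS/syz_map_graded.
- by move=> e w hw; apply: (@syz_map_lift j.+1 e w); apply/syz_pieceS.
Qed.

Definition linear_res : min_graded_res P.
Proof.
refine (@MinGradedRes K m E P (fun j => syz_rank (syz j)) (fun j _ => d + j%:Z)
  (fun j => lin1_mx (syz_map j)) (cover_map lp) _ _ _ _ _ _).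
- by move=> j k v hv; rewrite mul_rV_lin1; apply/syz_piece_homg/syz_map_graded.
- exact: aug_graded.
- exact: aug_surj.
- by move=> v; rewrite aug_exact; split=> -[u ->]; exists u; rewrite mul_rV_lin1.
- move=> j v; rewrite mul_rV_lin1 syz_exact.
  by split=> -[u ->]; exists u; rewrite mul_rV_lin1.
move=> j i l; rewrite /lin1_mx mxE.
(* A unit vector has degree d + j + 1, so the entries of its image in F_j are linear forms, without
   constant term. *)
have /syz_map_graded/syz_piece_homg/homgE : homg (d + j.+1%:Z) (d + j.+1%:Z) (delta_mx 0 i : 'rV[R]_(syz_rank (syz j.+1))).
  apply/homgE => k a ne; rewrite mxE; case: (_ && _); last by rewrite mcoeff0.
  rewrite mcoeff1; case: eqP => // a0.
  by rewrite a0 mdeg0 add0r eqxx in ne.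
apply; rewrite mdeg0; lia.
Defined.

Lemma klinear_resolution : has_linear_resolution d P.
Proof.
exists linear_res => j k ne; apply/eqP; rewrite cards_eq0; apply/eqP/setP => l.
by rewrite !inE /= eq_sym (negPf ne).
Qed.

End Iteration.
End KoszulToResolution.

(** * The Koszul complex in a given multidegree *)

Section MultigradedKoszul.
Variables (K : fieldType) (n : nat) (M : multigradedModule K n).
Local Notation S := {mpoly K[n]}.
Local Notation kdM := (kdiff (fun j : 'I_n => 'X_j : S)).

Lemma mpiece_0 b : mpiece b (0 : M).
Proof. exact: multigrading0 (mpieceP M) b. Qed.

Lemma mpieceD b (u v : M) : mpiece b u -> mpiece b v -> mpiece b (u + v).
Proof. exact: multigradingD (mpieceP M) b u v. Qed.

Lemma mpieceXZ a b c (v : M) : mpiece b v -> mpiece (a + b)%MM ((c *: 'X_[a]) *: v).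
Proof. exact: multigradingZ (mpieceP M) a b c v. Qed.

Lemma mpieceZ b c (v : M) : mpiece b v -> mpiece b (c%:MP *: v).
Proof. by move=> /(mpieceXZ 0 c); rewrite add0m mpolyX0 alg_mpolyC. Qed.

Lemma mpieceN b (v : M) : mpiece b v -> mpiece b (- v).
Proof. by move=> /(mpieceZ (-1)); rewrite rmorphN1 scaleN1r. Qed.

(* Elements of multidegree [b] in the Koszul complex of M on the variables of *)
(* indices in [s], with components of total degree [e]. The subtraction of    *)
(* multidegrees is truncated, so this is meaningful only if no [j] occurs     *)
(* more than [b j] times in [s].                                              *)
Fixpoint kmult (s : seq 'I_n) (b : 'X_{1..n}) (e : int) :
    kos M (size s) -> Prop :=
  if s is j :: s' then
    fun z => kmult b e z.1 /\ kmult (b - U_(j))%MM e z.2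
  else fun z => mpiece b z /\ ((mdeg b)%:Z != e -> z = 0).

Definition kmult_exact (s : seq 'I_n) (b : 'X_{1..n}) (e : int) : Prop :=
  forall z : kos M (size s), kmult b e z -> kdM z = 0 ->
  exists2 w, kmult b (e - 1) w & kdM w = z.

Lemma kmultD s b e (z w : kos M (size s)) :
  kmult b e z -> kmult b e w -> kmult b e (z + w).
Proof.
elim: s b z w => [|j s IHs] b z w /=.
  move=> [bz z0] [bw w0]; split; first exact: mpieceD.
  by move=> ne; rewrite z0 // w0 // addr0.
by move=> [? ?] [? ?]; split; apply: IHs.
Qed.

Lemma kmultN s b e (z : kos M (size s)) : kmult b e z -> kmult b e (- z).
Proof.
elim: s b z => [|j s IHs] b z /=; last by move=> [? ?]; split; apply: IHs.
by move=> [bz z0]; split; [exact: mpieceN | move=> /z0->; rewrite oppr0].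
Qed.

Definition kmult_mor s s' (f : kos M (size s) -> kos M (size s')) : Prop :=
  [/\ linear f, forall z, f (kdM z) = kdM (f z)
    & forall b e z, kmult b e z -> kmult b e (f z)].

(** A one-sided inverse is enough to carry exactness from s to s'. *)
Definition kmult_iso s s' : Prop :=
  exists (f : kos M (size s) -> kos M (size s')) g,
    [/\ kmult_mor f, kmult_mor g & cancel g f].

Lemma kmult_iso_exact s s' b e :
  kmult_iso s s' -> kmult_exact s b e -> kmult_exact s' b e.
Proof.
move=> [f [g [[_ fd fk] [glin gd gk] gK]]] ex z bz dz.
have g0 : g 0 = 0 by have := glin (-1) 0 0; rewrite scaler0 addr0 scaleN1r addNr.
have [||w bw dw] := ex (g z); first exact: gk.
  by rewrite -gd dz.
by exists (f w); [exact: fk | rewrite -fd dw gK].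
Qed.

Lemma kmult_iso_refl s : kmult_iso s s.
Proof. by exists id, id. Qed.

Lemma kmult_iso_trans s1 s2 s3 :
  kmult_iso s1 s2 -> kmult_iso s2 s3 -> kmult_iso s1 s3.
Proof.
move=> [f [g [[fl fd fk] [gl gd gk] gK]]] [f' [g' [[fl' fd' fk'] [gl' gd' gk'] gK']]].
exists (f' \o f), (g \o g'); split; last exact: can_comp.
  by split=> [c u v|z|b e z bz] /=; rewrite ?fl ?fl' ?fd ?fd' //; apply/fk'/fk.
by split=> [c u v|z|b e z bz] /=; rewrite ?gl' ?gl ?gd' ?gd //; apply/gk/gk'.
Qed.

Lemma linearZD (U V : lmodType S) (f : U -> V) : linear f ->
  (forall c u, f (c *: u) = c *: f u) /\ {morph f : u v / u + v}.
Proof.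
move=> fl; have f0 : f 0 = 0 by have := fl (-1) 0 0; rewrite scaler0 addr0 scaleN1r addNr.
by split=> [c u|u v]; [have := fl c u 0 | have := fl 1 u v]; rewrite ?f0 ?addr0 ?scale1r.
Qed.

Lemma kmult_mor_cons j s s' (f : kos M (size s) -> kos M (size s')) :
  kmult_mor f ->
  @kmult_mor (j :: s) (j :: s') (fun z => (f z.1, f z.2)).
Proof.
case=> fl fd fk; have [fZ fD] := linearZD fl; split.
- by move=> c u v /=; rewrite !fl.
- by move=> z /=; rewrite fD fZ fd -scaleN1r fZ fd scaleN1r.
- by move=> b e z /= [? ?]; split; apply: fk.
Qed.

Lemma kmult_iso_cons j s s' : kmult_iso s s' -> kmult_iso (j :: s) (j :: s').
Proof.
move=> [f [g [fm gm gK]]]; exists (fun z => (f z.1, f z.2)), (fun z => (g z.1, g z.2)).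
split; [exact: kmult_mor_cons fm | exact: kmult_mor_cons gm |].
by move=> [a c] /=; rewrite !gK.
Qed.

Lemma kdiff_cons1 j s (a c : kos M (size s)) :
  kdiff (fun j : 'I_n => 'X_j : S) ((a, c) : kos M (size (j :: s))) =
  (kdM a + 'X_j *: c, - kdM c).
Proof. by []. Qed.

Lemma kdiff_cons2 i j s (p q r t : kos M (size s)) :
  kdiff (fun j : 'I_n => 'X_j : S) (((p, q), (r, t)) : kos M (size (i :: j :: s))) =
  ((kdM p + 'X_j *: q + 'X_i *: r, - kdM q + 'X_i *: t),
   (- kdM r - 'X_j *: t, kdM t)).
Proof.
rewrite -[in RHS]opprD -[kdM t in RHS]opprK.
reflexivity.
Qed.

(** A chain ((p, q), (r, t)) stands for p + e_j q + e_i r + e_i e_j t; the sign comes from e_i e_j =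
    - e_j e_i. *)
Definition kswap (s : seq 'I_n) i j (z : kos M (size (i :: j :: s))) :
    kos M (size (j :: i :: s)) :=
  ((z.1.1, z.2.1), (z.1.2, - z.2.2)).

Lemma kswap_mor s i j : kmult_mor (@kswap s i j).
Proof.
split.
- by move=> c u v; congr ((_, _), (_, _)); rewrite /= opprD scalerN.
- move=> [[p q] [r t]]; rewrite /kswap [in RHS]kdiff_cons2 [in LHS]kdiff_cons2.
  congr ((_, _), (_, _)) => /=.
  + exact: addrAC.
  + by rewrite scalerN.
  + by rewrite scalerN opprK.
  + by rewrite kdiffN.
- move=> b e [[p q] [r t]] /= [[? ?] [? tb]]; do !split => //.
  by apply: kmultN; rewrite submDA addmC -submDA.
Qed.

Lemma kmult_iso_swap i j s : kmult_iso (i :: j :: s) (j :: i :: s).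
Proof.
exists (@kswap s i j), (@kswap s j i); split; try exact: kswap_mor.
by move=> [[p q] [r t]]; rewrite /kswap /= opprK.
Qed.

Lemma kmult_iso_perm s s' : perm_eq s s' -> kmult_iso s s'.
Proof.
elim: s s' => [|x s IHs] s' eq_s.
  by move: eq_s; rewrite perm_sym => /perm_nilP->; exact: kmult_iso_refl.
have xs' : x \in s' by rewrite -(perm_mem eq_s) mem_head.
case/splitPr: xs' eq_s => s1 s2.
rewrite perm_sym perm_catC /= perm_cons perm_catC perm_sym => /IHs/(kmult_iso_cons x).
move/kmult_iso_trans; apply; elim: s1 => [|y s1 IHs1] /=; first exact: kmult_iso_refl.
by apply: kmult_iso_trans (kmult_iso_swap _ _ _) (kmult_iso_cons y IHs1).
Qed.

(* The Koszul complex on a repeated variable splits, after the base change    *)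
(* e' := e' - e, into two copies of the one on a single variable.             *)
Lemma kmult_exact_dup j s b e :
  kmult_exact (j :: s) b e -> kmult_exact (j :: s) (b - U_(j))%MM e ->
  kmult_exact (j :: j :: s) b e.
Proof.
have kos_pair k (z : kos M k.+1) : exists a c : kos M k, z = (a, c).
  by exists z.1, z.2; case: z.
move=> ex1 ex2 z.
have [a [c ->]] := kos_pair _ z.
have [p [q ->]] := kos_pair _ a; have [r [t ->]] := kos_pair _ c.
move=> [[bp bq] [br bt]] dz.
have [dp dq dr dt] := etrans (esym (@kdiff_cons2 j j s p q r t)) dz.
(* With e and e' the generators of the outer and the inner copy of j, the chain is (p + e'(q + r)) +
   (e - e')(r + e' t), and e - e' has differential zero. *)
have [||w' bw' dw'] := ex1 (p, q + r).
- by split=> //; exact: kmultD.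
- rewrite kdiff_cons1; congr pair; first by rewrite scalerDr addrA.
  rewrite kdiffD; move/eqP: dq; rewrite addrC subr_eq0 => /eqP <-.
  by move/eqP: dr; rewrite subr_eq0 => /eqP <-; rewrite addNr oppr0.
have [||w bw dw] := ex2 (r, t).
- by split.
- by rewrite kdiff_cons1; congr pair; [apply: oppr_inj; rewrite opprD dr oppr0 | rewrite dt oppr0].
have [p' [q' ew']] := kos_pair _ w'; have [r' [t' ew]] := kos_pair _ w.
rewrite {}ew' {}ew in bw' dw' bw dw.
case: bw' => bp' bq'; rewrite kdiff_cons1 in dw'; case: dw' => dp' dq'.
case: bw => br' bt'; rewrite kdiff_cons1 in dw; case: dw => dr' dt'.
(* This is (p' + e' q') - (e - e')(r' + e' t') rewritten in e and e'; the sign is there because d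
   anticommutes with e - e'. *)
exists ((p', q' + r'), (- r', - t')).
  by do !split=> //; [exact: kmultD | exact: kmultN | exact: kmultN].
rewrite kdiff_cons2 !scalerN !kdiffN dt' opprK; congr ((_, _), (_, _)) => //.
- by rewrite scalerDr addrA addrK.
- by rewrite kdiffD opprD dq' -addrA -opprD dr' addrK.
- by rewrite opprK.
Qed.

(** The entries of s are exactly the support of b, repeated at most as often as the exponents allow,
    so that truncated subtraction in [kmult] is harmless. *)
Definition admissible (s : seq 'I_n) (b : 'X_{1..n}) : Prop :=
  forall j, (count_mem j s <= b j)%N /\ (b j != 0%N -> j \in s).

(** Induction on the length: [kmult_exact_dup] drops one copy of a repeated j, and the shorter list
    is admissible for b and for b - U_(j), because b j is at least 2. *)
Lemma kmult_exact_admissible d :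
    (forall b e, e != d -> exists s, [/\ uniq s, admissible s b & kmult_exact s b e]) ->
  forall s b e, admissible s b -> e != d -> kmult_exact s b e.
Proof.
move=> ex s b e; have [k] := ubnP (size s); elim: k s b => // k IHk s b lt_sk adm ne.
have [us|nus] := boolP (uniq s).
  (* Up to order there is only one admissible list for b without repetition. *)
  have [s' [us' adm' ex']] := ex b e ne; apply: kmult_iso_exact ex'.
  apply/kmult_iso_perm/uniq_perm => // j.
  have mem r : uniq r -> admissible r b -> (j \in r) = (b j != 0%N).
    move=> ur /(_ j)[cj bj]; apply/idP/idP => // jr.
    by move: cj; rewrite count_uniq_mem // jr -lt0n.
  by rewrite !mem.
have [j cj] : exists j, (1 < count_mem j s)%N.
  apply: contrapT => h; case/negP: nus; apply: count_mem_uniq => j.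
  have : (count_mem j s <= 1)%N by rewrite leqNgt; apply/negP => cj; apply: h; exists j.
  by rewrite -has_pred1 has_count; case: (count_mem j s) => [|[|]].
have [s' eq_s] : exists s', perm_eq (j :: j :: s') s.
  have js : j \in s by rewrite -has_pred1 has_count ltnW.
  have js' : j \in rem j s.
    move: cj; rewrite -has_pred1 has_count (permP (perm_to_rem js)) /= eqxx.
    by rewrite add1n ltnS.
  exists (rem j (rem j s)); rewrite perm_sym (perm_trans (perm_to_rem js)) // perm_cons.
  exact: perm_to_rem.
have admE i : ((i == j) * 2 + count_mem i s' <= b i)%N /\ (b i != 0%N -> i \in j :: s').
  have [ci bi] := adm i; split.
    by move: ci; rewrite -(permP eq_s) /= [j == i]eq_sym; case: (i == j) => /=; lia.
  by move/bi; rewrite -(perm_mem eq_s) !inE orbA orbb.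
have szs : (size (j :: s') < k)%N by move: lt_sk; rewrite -(perm_size eq_s).
apply: (kmult_iso_exact (kmult_iso_perm eq_s)); apply: kmult_exact_dup; apply: IHk => //.
  move=> i; have [ci bi] := admE i; split=> //=.
  by move: ci; rewrite [j == i]eq_sym; case: (i == j) => /=; lia.
move=> i; have [ci bi] := admE i; split=> /=.
  by move: ci; rewrite mnmBE mnm1E [j == i]eq_sym; case: (i == j) => /=; lia.
by rewrite mnmBE => h; apply: bi; apply: contraNneq h => ->.
Qed.

End MultigradedKoszul.

(** * Modules assembled from components of M along a map of variables *)

Section Pullback.
Variables (K : fieldType) (n m : nat) (tau : 'I_m -> 'I_n).
Variable M : multigradedModule K n.
Local Notation S := {mpoly K[n]}.
Local Notation R := {mpoly K[m]}.

Definition mnm_push (b : 'X_{1..m}) : 'X_{1..n} :=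
  [multinom (\sum_(v | tau v == j) b v)%N | j < n].

Lemma mnm_pushD b c : mnm_push (b + c) = (mnm_push b + mnm_push c)%MM.
Proof.
by apply/mnmP => j; rewrite mnmDE !mnmE -big_split; apply: eq_bigr => v _; rewrite mnmDE.
Qed.

Lemma mnm_pushU v : mnm_push U_(v) = U_(tau v)%MM.
Proof.
apply/mnmP => j; rewrite mnmE mnm1E; under eq_bigr do rewrite mnm1E.
case: eqP => [<-|ne].
  by rewrite (bigD1 v) //= eqxx big1 // => w /andP[_]; rewrite eq_sym => /negPf ->.
by rewrite big1 // => w /eqP wj; case: eqP => // vw; case: ne; rewrite vw.
Qed.

Lemma mnm_pushB (b : 'X_{1..m}) v : b v != 0%N ->
  mnm_push (b - U_(v)) = (mnm_push b - U_(tau v))%MM.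
Proof.
move=> bv; have Ub : (U_(v) <= b)%MM by rewrite lep1mP.
by rewrite -{2}(submK Ub) mnm_pushD mnm_pushU addmK.
Qed.

Lemma mdeg_push b : mdeg (mnm_push b) = mdeg b.
Proof.
rewrite !mdegE (partition_big tau predT) //=.
by apply: eq_bigr => j _; rewrite mnmE.
Qed.

(* E is the direct sum of copies of the M_(mnm_push b), one in each           *)
(* multidegree b, with the v-th variable acting as the (tau v)-th one.        *)
Record pullback (E : lmodType R) (P : int -> E -> Prop)
    (theta : 'X_{1..m} -> E -> M) : Prop := {
  pbD : forall b, {morph theta b : u v / u + v};
  pbZ : forall b c u, theta b (c%:MP *: u) = c%:MP *: theta b u;
  pbX : forall b v u, theta (b + U_(v))%MM ('X_v *: u) = 'X_(tau v) *: theta b u;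
  pbX0 : forall (b : 'X_{1..m}) v u, b v = 0%N -> theta b ('X_v *: u) = 0;
  pb_piece : forall b u, mpiece (mnm_push b) (theta b u);
  pb_inj : forall u, (forall b, theta b u = 0) -> u = 0;
  pb_fin : forall u, exists s : seq 'X_{1..m}, forall b, b \notin s -> theta b u = 0;
  pb_lift : forall b y, mpiece (mnm_push b) y ->
    exists u, [/\ P (mdeg b)%:Z u, theta b u = y & forall c, c != b -> theta c u = 0];
  pbP : forall e u, P e u <-> forall b, (mdeg b)%:Z != e -> theta b u = 0
}.

Section Theory.
Variables (E : lmodType R) (P : int -> E -> Prop) (theta : 'X_{1..m} -> E -> M).
Hypothesis pb : pullback P theta.

Local Notation kdE := (kdiff (fun v : 'I_m => 'X_v : R)).
Local Notation kdt := (kdiff (fun v : 'I_m => 'X_(tau v) : S)).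

Lemma pb0 b : theta b 0 = 0.
Proof. by apply: (addrI (theta b 0)); rewrite -(pbD pb) !addr0. Qed.

Lemma pullback_grading : grading P.
Proof.
apply: (grading_of (pbD pb) (pb_inj pb) (pbP pb)).
  by move=> e c u /(pbP pb) hu; apply/(pbP pb) => b ne; rewrite (pbZ pb) hu ?scaler0.
move=> e v u /(pbP pb) hu; apply/(pbP pb) => b ne.
have [bv|bv] := eqVneq (b v) 0%N; first exact: (pbX0 pb).
have Ub : (U_(v) <= b)%MM by rewrite lep1mP.
rewrite -(submK Ub) (pbX pb) hu ?scaler0 //; apply: contra ne => /eqP <-.
by rewrite -{1}(submK Ub) mdegD mdeg1 PoszD.
Qed.

(** The part of multidegree b of the Koszul complex of E, written in M; a generator e_v with b v = 0
    does not occur in it. *)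
Fixpoint kpull (t : seq 'I_m) (b : 'X_{1..m}) (e : int) : kos M (size t) -> Prop :=
  if t is v :: t' then fun z => kpull b e z.1 /\
    (if b v == 0%N then z.2 = 0 else kpull (b - U_(v))%MM e z.2)
  else fun z => mpiece (mnm_push b) z /\ ((mdeg b)%:Z != e -> z = 0).

Fixpoint ktheta (t : seq 'I_m) (b : 'X_{1..m}) : kos E (size t) -> kos M (size t) :=
  if t is v :: t' then fun z =>
    (ktheta b z.1, if b v == 0%N then 0 else ktheta (b - U_(v))%MM z.2)
  else theta b.

Lemma kthetaD t b (z w : kos E (size t)) :
  ktheta b (z + w) = ktheta b z + ktheta b w.
Proof.
elim: t b z w => [|v t IHt] b z w /=; first exact: (pbD pb).
by congr pair; [exact: IHt | case: eqP => _; [rewrite addr0 | exact: IHt]].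
Qed.

Lemma ktheta0 t b : ktheta b (0 : kos E (size t)) = 0.
Proof. by apply: (addrI (ktheta b (0 : kos E (size t)))); rewrite -kthetaD !addr0. Qed.

Lemma kthetaN t b (z : kos E (size t)) : ktheta b (- z) = - ktheta b z.
Proof. by apply/eqP; rewrite -addr_eq0 -kthetaD addNr ktheta0. Qed.

(** As v is not in t, subtracting U_(v) does not affect which variables of t divide x^b. *)
Lemma kthetaX t b v (z : kos E (size t)) : v \notin t ->
  ktheta b ('X_v *: z) =
  if b v == 0%N then 0 else 'X_(tau v) *: ktheta (b - U_(v))%MM z.
Proof.
elim: t b z => [|w t IHt] b z /=.
  move=> _; case: eqP => [bv|/eqP bv]; first exact: (pbX0 pb).
  have Ub : (U_(v) <= b)%MM by rewrite lep1mP.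
  by rewrite -{1}(submK Ub) (pbX pb).
rewrite inE negb_or => /andP[vw vt]; rewrite !IHt //.
rewrite !mnmBE !mnm1E [w == v]eq_sym !(negPf vw) !subn0 !submDA [(U_(w) + _)%MM]addmC.
case: (b v == 0%N); first by rewrite if_same.
by congr pair => /=; case: (b w == 0%N); rewrite ?scaler0.
Qed.

Lemma ktheta_kdiff t b (z : kos E (size t)) : uniq t ->
  ktheta b (kdE z) = kdt (ktheta b z).
Proof.
elim: t b z => [|v t IHt] b z /=; first by rewrite pb0.
case/andP=> vt ut; congr pair.
  by rewrite kthetaD IHt // kthetaX //; case: eqP => _ //; rewrite scaler0.
by case: eqP => _; [rewrite kdiff_0 oppr0 | rewrite kthetaN IHt].
Qed.

Lemma ktheta_inj t (z : kos E (size t)) : (forall b, ktheta b z = 0) -> z = 0.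
Proof.
elim: t z => [|v t IHt] z /= z0; first exact: (pb_inj pb) z0.
rewrite [z]surjective_pairing; congr pair; apply: IHt => b.
  exact: (congr1 fst (z0 b)).
by have := congr1 snd (z0 (b + U_(v))%MM); rewrite /= mnmDE mnm1E eqxx addn1 addmK.
Qed.

Lemma ktheta_fin t (z : kos E (size t)) :
  exists s : seq 'X_{1..m}, forall b, b \notin s -> ktheta b z = 0.
Proof.
elim: t z => [|v t IHt] z /=; first exact: (pb_fin pb).
have [s1 h1] := IHt z.1; have [s2 h2] := IHt z.2.
exists (s1 ++ [seq (b + U_(v))%MM | b <- s2]) => b.
rewrite mem_cat negb_or => /andP[bs1 bs2]; congr pair; first exact: h1.
case: eqP => // /eqP bv; apply: h2; apply: contra bs2 => bs2.
by apply/mapP; exists (b - U_(v))%MM => //; rewrite submK // lep1mP.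
Qed.

Lemma ktheta_pull t b e (z : kos E (size t)) :
  kall (P e) z -> kpull b e (ktheta b z).
Proof.
elim: t b z => [|v t IHt] b z /=.
  by move=> /(pbP pb) hz; split; [exact: (pb_piece pb) | exact: hz].
by case=> P1 P2; split; [exact: IHt | case: eqP => // _; exact: IHt].
Qed.

Lemma ktheta_lift t b e (y : kos M (size t)) : kpull b e y ->
  exists z, [/\ kall (P e) z, ktheta b z = y & forall c, c != b -> ktheta c z = 0].
Proof.
have P0 := gr0 pullback_grading e.
elim: t b y => [|v t IHt] b y /=.
  case=> by_ y0; have [be|ne] := eqVneq (mdeg b)%:Z e.
    by have [u [Pu uy u0]] := pb_lift pb by_; exists u; rewrite -be.
  by exists 0; rewrite y0 //; split=> // [|c _]; exact: pb0.
case=> /IHt[z1 [P1 t1 u1]]; case: eqP => [bv y2|/eqP bv /IHt[z2 [P2 t2 u2]]].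
  exists (z1, 0); split=> /=; first by split=> //; exact: kall0.
    by rewrite t1 [RHS]surjective_pairing y2.
  by move=> c cb; congr pair; [exact: u1 | case: eqP => // _; exact: ktheta0].
exists (z1, z2); split=> //=; first by rewrite t1 t2 -surjective_pairing.
move=> c cb; congr pair; first exact: u1.
case: eqP => // /eqP cv; apply: u2; apply: contra cb => /eqP cb.
have Uc : (U_(v) <= c)%MM by rewrite lep1mP.
have Ub : (U_(v) <= b)%MM by rewrite lep1mP.
by rewrite -(submK Uc) cb submK.
Qed.

(** The Koszul complex of E is the direct sum of its multidegree parts, which [ktheta] reads in M;
    exactness is tested on each part. *)
Lemma klinear_pull d : klinear P d <->
  forall b e, e != d -> forall y : kos M (size (enum 'I_m)),
    kpull b e y -> kdt y = 0 -> exists2 w, kpull b (e - 1) w & kdt w = y.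
Proof.
have uE := enum_uniq 'I_m.
split=> [lin b e ne y by_ dy | ex e ne z Pz dz].
  have [z [Pz zy z0]] := ktheta_lift by_.
  have [||w Pw dw] := lin e ne z => //.
    apply: ktheta_inj => c; rewrite ktheta_kdiff //.
    by have [->|cb] := eqVneq c b; [rewrite zy | rewrite z0 // kdiff_0].
  exists (ktheta b w); first exact: ktheta_pull.
  by rewrite -ktheta_kdiff // dw.
have [s hs] := ktheta_fin z.
have /choice[L hL] (b : 'X_{1..m}) : exists w : kos E (size (enum 'I_m)),
    [/\ kall (P (e - 1)) w, kdt (ktheta b w) = ktheta b z &
        forall c, c != b -> ktheta c w = 0].
  have [||y by_ dy] := ex b e ne (ktheta b z); first exact: ktheta_pull.
    by rewrite -ktheta_kdiff // dz ktheta0.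
  by have [w [Pw wy w0]] := ktheta_lift by_; exists w; rewrite wy.
(* Only the multidegrees in s contribute to z, so the chains bounding its parts have a finite
   sum. *)
exists (\sum_(b <- undup s) L b).
  apply: (big_ind (@kall R E (P (e - 1)) _)) => [|u v|b _]; last by case: (hL b).
    exact/kall0/(gr0 pullback_grading).
  exact/kallD/(grD pullback_grading).
have kthetaS c : ktheta c (\sum_(b <- undup s) L b) = \sum_(b <- undup s) ktheta c (L b).
  by apply: (big_morph (ktheta c)); [exact: kthetaD | exact: ktheta0].
apply/eqP; rewrite -subr_eq0; apply/eqP/ktheta_inj => c.
rewrite kthetaD kthetaN ktheta_kdiff // kthetaS.
have [cs|cs] := boolP (c \in s).
  rewrite (bigD1_seq c) ?mem_undup ?undup_uniq //= big1 => [|b bc].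
    by rewrite addr0; have [_ -> _] := hL c; rewrite subrr.
  by have [_ _ ->] := hL b; rewrite // eq_sym.
rewrite hs // subr0 big1_seq ?kdiff_0 // => b /andP[_]; rewrite mem_undup => bs.
by have [_ _ ->] := hL b => //; apply: contraNneq cs => ->.
Qed.

End Theory.
End Pullback.

Section PullbackResolution.
Variables (K : fieldType) (n m : nat) (tau : 'I_m -> 'I_n).
Variable M : multigradedModule K n.
Local Notation S := {mpoly K[n]}.
Local Notation R := {mpoly K[m]}.
Local Notation kdM := (kdiff (fun j : 'I_n => 'X_j : S)).
Local Notation kdt := (kdiff (fun v : 'I_m => 'X_(tau v) : S)).

(* Only the variables in the support of [b] contribute in multidegree [b].    *)
Lemma kpull_support (p : pred 'I_m) (t : seq 'I_m) :
  exists f : kos M (size (map tau (filter p t))) -> kos M (size t),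
  [/\ linear f, injective f, forall z, f (kdM z) = kdt (f z) &
    forall (b : 'X_{1..m}) e, uniq t ->
      (forall v, v \in t -> (b v != 0%N) = p v) ->
      (forall z, kmult (mnm_push tau b) e z -> kpull tau b e (f z)) /\
      (forall y, kpull tau b e y ->
        exists2 z, kmult (mnm_push tau b) e z & f z = y)].
Proof.
elim: t => [|v t [f [flin finj fd fP]]] /=.
  exists id; split=> // b e _ _; rewrite mdeg_push; split=> // y hy; by exists y.
have [fZ fD] := linearZD flin.
case: ifP => pv /=.
  exists (fun z => (f z.1, f z.2)); split.
  - by move=> c u w /=; rewrite !flin.
  - by move=> [a c] [a' c'] /= [/finj -> /finj ->].
  - move=> z /=; congr pair; first by rewrite fD fZ fd.
    by rewrite -scaleN1r fZ scaleN1r fd.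
  move=> b e /andP[vt ut] bp.
  have bv : b v != 0%N by rewrite bp ?mem_head.
  have bp1 w : w \in t -> (b w != 0%N) = p w by move=> wt; apply: bp; rewrite inE wt orbT.
  have bp2 w : w \in t -> ((b - U_(v))%MM w != 0%N) = p w.
    move=> wt; have /negPf vw : v != w by apply: contraNneq vt => ->.
    by rewrite mnmBE mnm1E vw subn0 bp1.
  have [f1 f2] := fP b e ut bp1; have [f3 f4] := fP (b - U_(v))%MM e ut bp2.
  rewrite (negPf bv) -mnm_pushB //; split=> [z [h1 h2]|y [/f2[z1 h1 e1] /f4[z2 h2 e2]]].
    by split; [exact: f1 | exact: f3].
  by exists (z1, z2) => //=; rewrite e1 e2 -surjective_pairing.
(* A variable v outside the support of b has no chains in multidegree b, so zero is inserted for
   it. *)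
exists (fun z => (f z, 0)); split.
- by move=> c u w; congr pair; rewrite /= ?flin // scaler0 addr0.
- by move=> z w /= [/finj].
- by move=> z /=; rewrite fd scaler0 addr0; congr pair; rewrite kdiff_0 oppr0.
move=> b e /andP[vt ut] bp.
have bv : b v = 0%N by apply/eqP; rewrite -[_ == _]negbK bp ?mem_head ?pv.
have bp1 w : w \in t -> (b w != 0%N) = p w by move=> wt; apply: bp; rewrite inE wt orbT.
have [f1 f2] := fP b e ut bp1; rewrite bv eqxx.
split=> [z hz|y [/f2[z hz ez] y2]]; first by split=> //; exact: f1.
by exists z; rewrite // [RHS]surjective_pairing y2 ez.
Qed.

Definition support_seq (b : 'X_{1..m}) : seq 'I_n :=
  map tau (filter (fun v => b v != 0%N) (enum 'I_m)).

Lemma kpull_exact_support (b : 'X_{1..m}) e :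
  (forall y : kos M (size (enum 'I_m)), kpull tau b e y -> kdt y = 0 ->
    exists2 w, kpull tau b (e - 1) w & kdt w = y) <->
  kmult_exact M (support_seq b) (mnm_push tau b) e.
Proof.
have [f [flin finj fd fP]] := kpull_support (fun v => b v != 0%N) (enum 'I_m).
have [f1 f2] := fP b e (enum_uniq _) (fun _ _ => erefl).
have [f3 f4] := fP b (e - 1) (enum_uniq _) (fun _ _ => erefl).
have f0 : f 0 = 0 by have := flin (-1) 0 0; rewrite scaler0 addr0 scaleN1r addNr.
split=> [ex z hz dz|ex _ /f2[z hz <-] dz].
  have [||_ /f4[w hw <-]] := ex (f z); first exact: f1.
    by rewrite -fd dz.
  by rewrite -fd => /finj dw; exists w.
have [|w hw dw] := ex z hz; first by apply: finj; rewrite fd dz.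
by exists (f w); [exact: f3 | rewrite -fd dw].
Qed.

Lemma support_admissible b : admissible (support_seq b) (mnm_push tau b).
Proof.
move=> j; split.
  rewrite -sum1_count big_map big_filter_cond big_enum_cond mnmE /=.
  rewrite big_mkcondl /= leq_sum // => v _; by case: (b v).
rewrite mnmE sum_nat_eq0 negb_forall => /existsP[v].
rewrite negb_imply => /andP[/eqP vj bv]; apply/mapP; exists v => //.
by rewrite mem_filter bv mem_enum.
Qed.

(** From right to left, the lists that occur for E are admissible. From left to right,
    [kmult_exact_admissible] asks for only one repetition-free list in each multidegree of M. *)
Lemma klinear_admissible (E : lmodType R) (P : int -> E -> Prop)
    (theta : 'X_{1..m} -> E -> M) d :
    pullback tau P theta -> (forall j, exists v, tau v = j) ->
  klinear P d <->
  forall s b e, admissible s b -> e != d -> kmult_exact M s b e.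
Proof.
move=> pb /choice[sg sgK]; rewrite (klinear_pull pb); split=> [ex|ex b e ne]; last first.
  by apply/kpull_exact_support/ex => //; exact: support_admissible.
apply: kmult_exact_admissible => b e ne.
(* The whole exponent b j is put on the single variable [sg j]; thus c pushes to b and its support
   list has no repetition. *)
pose c : 'X_{1..m} := [multinom if sg (tau v) == v then b (tau v) else 0%N | v < m].
have cE v : c v = if sg (tau v) == v then b (tau v) else 0%N by rewrite mnmE.
have <- : mnm_push tau c = b.
  apply/mnmP => j; rewrite mnmE (bigD1 (sg j)) ?sgK //= cE sgK eqxx.
  rewrite big1 ?addn0 // => v /andP[/eqP vj vs]; rewrite cE vj.
  by rewrite eq_sym (negPf vs).
exists (support_seq c); split; last by apply/kpull_exact_support; exact: ex.
  rewrite map_inj_in_uniq => [|v w]; first exact/filter_uniq/enum_uniq.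
  have cK u : c u != 0%N -> sg (tau u) = u by rewrite cE; case: (_ =P u).
  by rewrite !mem_filter => /andP[/cK hv _] /andP[/cK hw _] vw; rewrite -hv vw hw.
exact: support_admissible.
Qed.

End PullbackResolution.

(** * Linear resolutions of pullbacks *)

Section PullbackLinear.
Variables (K : fieldType) (n m : nat) (tau : 'I_m -> 'I_n).
Variable M : multigradedModule K n.
Local Notation R := {mpoly K[m]}.
Variables (E : lmodType R) (P : int -> E -> Prop) (theta : 'X_{1..m} -> E -> M).
Hypothesis pb : pullback tau P theta.
Hypothesis finM : forall b, fin_dim (mpiece b : M -> Prop).

Let gr : grading P := pullback_grading pb.

Lemma theta_sum I (s : seq I) b (F : I -> E) :
  theta b (\sum_(i <- s) F i) = \sum_(i <- s) theta b (F i).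
Proof. by apply: (big_morph (theta b)); [exact: (pbD pb) | exact: (pb0 pb)]. Qed.

Lemma theta_comb r b (h : 'I_r -> E) c :
  theta b (comb h c) = comb (fun i => theta b (h i)) c.
Proof. by rewrite theta_sum; apply: eq_bigr => i _; rewrite (pbZ pb). Qed.

Lemma thetaB b u v : theta b (u - v) = theta b u - theta b v.
Proof.
rewrite (pbD pb); congr (_ + _); apply/eqP.
by rewrite -addr_eq0 -(pbD pb) addNr (pb0 pb).
Qed.

(** Subtracting a combination of lifts of a basis of M in multidegree [mnm_push tau b] removes b
    from the support. *)
Lemma fin_dim_support (s : seq 'X_{1..m}) :
  fin_dim (fun u => forall b, b \notin s -> theta b u = 0).
Proof.
elim: s => [|b s [t [h' h'P]]].
  exists 0%N, (fun=> 0) => u u0; exists 0; rewrite comb0.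
  by apply: (pb_inj pb) => b; exact: u0.
have [r [h [hb _ hspan]]] := basis_of_fin_dim (@mpiece_0 _ _ M _)
  (@mpieceD _ _ M (mnm_push tau b)) (@mpieceZ _ _ M _) (finM _).
have /choice[H HP] i : exists u, theta b u = h i /\ forall c, c != b -> theta c u = 0.
  by have [u [_ ? ?]] := pb_lift pb (hb i); exists u.
exists (r + t)%N, (fun i => match split i with inl x => H x | inr y => h' y end) => u us.
have [c uc] := hspan _ (pb_piece pb b u).
have [|c' uc'] := h'P (u - comb H c).
  move=> d ds; rewrite thetaB theta_comb; have [->|db] := eqVneq d b.
    rewrite uc; apply/eqP; rewrite subr_eq0; apply/eqP.
    by apply: eq_bigr => i _; have [-> _] := HP i.
  rewrite us ?inE ?negb_or ?db // sub0r /comb big1 ?oppr0 // => i _.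
  by have [_ ->] := HP i; rewrite ?scaler0.
exists (row_mx c c'); rewrite /comb big_split_ord /= -[u](subrK (comb H c)) uc' [LHS]addrC.
congr (_ + _); apply: eq_bigr => i _.
  by rewrite row_mxEl (unsplitK (inl i)).
by rewrite row_mxEr (unsplitK (inr i)).
Qed.

Lemma pullback_linear_piece d : klinear P d -> linear_piece P d.
Proof.
move=> lin; split=> //.
- exact: gr0 gr.
- exact: grD gr.
- exact: grZ gr.
- exact: grX gr.
- exists 0 => e u e0 /(pbP pb) u0; apply: (pb_inj pb) => b; apply: u0.
  by apply: contraTneq e0 => <-.
(* This finite list contains all multidegrees of total degree d; there are none if d < 0. *)
pose s := [seq val b | b : 'X_{1..m < `|d|.+1}].
have [t [h hP]] := fin_dim_support s; exists t, h => u /(pbP pb) u0.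
apply: hP => b bs; apply: u0; apply: contra bs => /eqP bd.
have lt_b : (mdeg b < `|d|.+1)%N by rewrite -bd.
by apply/mapP; exists (BMultinom lt_b); rewrite ?mem_enum.
Qed.

Lemma pullback_generated u : exists2 s : seq E,
  (forall v, v \in s -> exists e, P e v) & u = \sum_(v <- s) v.
Proof.
have [s us] := pb_fin pb u.
have /choice[L LP] b : exists v, [/\ P (mdeg b)%:Z v, theta b v = theta b u &
    forall c, c != b -> theta c v = 0] by apply/(pb_lift pb)/(pb_piece pb).
exists (map L (undup s)) => [_ /mapP[b _ ->]|].
  by have [Pb _ _] := LP b; exists (mdeg b)%:Z.
apply/eqP; rewrite -subr_eq0; apply/eqP/(pb_inj pb) => c.
rewrite thetaB theta_sum big_map; have [cs|cs] := boolP (c \in s).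
  rewrite (bigD1_seq c) ?mem_undup ?undup_uniq //= big1 => [|b bc].
    by have [_ -> _] := LP c; rewrite addr0 subrr.
  by have [_ _ ->] := LP b; rewrite // eq_sym.
rewrite us // sub0r big1_seq ?oppr0 // => b /andP[_]; rewrite mem_undup => bs.
by have [_ _ ->] := LP b => //; apply: contraNneq cs => ->.
Qed.

(** The right-hand side mentions neither E nor tau, so any two such pullbacks of M can be compared
    through it. *)
Theorem linear_resolution_pullback d : (forall j, exists v, tau v = j) ->
  has_linear_resolution d P <->
  forall s b e, admissible s b -> e != d -> kmult_exact M s b e.
Proof.
move=> tau_surj; rewrite -(klinear_admissible d pb tau_surj); split=> [[F FL]|lin].
  exact: (linear_resolution_klinear gr FL).
exact: (klinear_resolution gr (pullback_linear_piece lin) pullback_generated).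
Qed.

End PullbackLinear.

(** * Multigraded components of M *)

Section Components.
Variables (K : fieldType) (n : nat) (M : multigradedModule K n).
Implicit Types (u v : M) (f g : 'X_{1..n} -> M).

(** The sum is taken over every list containing the support, so that two decompositions can be added
    or compared on a common list. *)
Definition is_mcomp u f : Prop :=
  (forall b, mpiece b (f b)) /\
  exists2 s : seq 'X_{1..n}, forall b, b \notin s -> f b = 0 &
    forall s', uniq s' -> {subset s <= s'} -> u = \sum_(b <- s') f b.

Lemma is_mcompD u v f g : is_mcomp u f -> is_mcomp v g ->
  is_mcomp (u + v) (fun b => f b + g b).
Proof.
move=> [fP [s fs us]] [gP [t gt vt]]; split=> [b|]; first exact: mpieceD.
exists (s ++ t) => [b|s' us' sub].
  by rewrite mem_cat negb_or => /andP[bs bt]; rewrite fs // gt // addr0.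
rewrite big_split -us // => [|b bs]; last by apply: sub; rewrite mem_cat bs.
by rewrite -vt // => b bt; apply: sub; rewrite mem_cat bt orbT.
Qed.

Lemma is_mcomp_piece b v : mpiece b v -> is_mcomp v (fun c => if c == b then v else 0).
Proof.
move=> bv; split=> [c|]; first by case: eqP => [->|_] //; exact: mpiece_0.
exists [:: b] => [c|s us sub]; first by rewrite inE => /negPf ->.
rewrite (bigD1_seq b) ?sub ?mem_head //= eqxx big1 ?addr0 // => c /negPf -> //.
Qed.

Lemma is_mcomp_exists u : exists f, is_mcomp u f.
Proof.
have [s [f [fP ->]]] := multigrading_span (mpieceP M) u.
elim: s => [|a s [g gP]].
  exists (fun=> 0); split=> [b|]; first exact: mpiece_0.
  by exists [::] => // s' _ _; rewrite big_nil big1.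
by rewrite big_cons; eexists; apply: is_mcompD gP; exact: is_mcomp_piece (fP a).
Qed.

Lemma is_mcomp_uniq u f g : is_mcomp u f -> is_mcomp u g -> forall b, f b = g b.
Proof.
move=> [fP [s fs us]] [gP [t gt ut]] b.
have [bst|] := boolP (b \in undup (s ++ t)); last first.
  by rewrite mem_undup mem_cat negb_or => /andP[bs bt]; rewrite fs // gt.
apply/eqP; rewrite -subr_eq0; apply/eqP.
apply: (multigrading_direct (mpieceP M) (f := fun b => f b - g b) (undup_uniq (s ++ t))) bst.
  by move=> c; apply: mpieceD => //; exact: mpieceN.
rewrite sumrB -us ?undup_uniq // => [|c cs]; last by rewrite mem_undup mem_cat cs.
rewrite -ut ?undup_uniq ?subrr // => c ct.
by rewrite mem_undup mem_cat ct orbT.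
Qed.

Definition mcomp (b : 'X_{1..n}) u : M := sval (cid (is_mcomp_exists u)) b.

Lemma mcompP u : is_mcomp u (mcomp ^~ u).
Proof. exact: svalP (cid (is_mcomp_exists u)). Qed.

Lemma mcompD b : {morph mcomp b : u v / u + v}.
Proof.
by move=> u v; apply: (is_mcomp_uniq (mcompP _) (is_mcompD (mcompP u) (mcompP v))).
Qed.

Lemma mcomp_piece b v c : mpiece b v -> mcomp c v = if c == b then v else 0.
Proof. by move=> bv; exact: (is_mcomp_uniq (mcompP v) (is_mcomp_piece bv)). Qed.

Lemma mcomp0 b : mcomp b 0 = 0.
Proof. by apply: (addrI (mcomp b 0)); rewrite -mcompD !addr0. Qed.

Lemma mcomp_sum I (s : seq I) b (F : I -> M) :
  mcomp b (\sum_(i <- s) F i) = \sum_(i <- s) mcomp b (F i).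
Proof. by apply: (big_morph (mcomp b)); [exact: mcompD | exact: mcomp0]. Qed.

Lemma sum_mcomp u : exists s : seq 'X_{1..n},
  [/\ uniq s, forall b, b \notin s -> mcomp b u = 0 & u = \sum_(b <- s) mcomp b u].
Proof.
have [_ [s s0 us]] := mcompP u; exists (undup s); split; first exact: undup_uniq.
  by move=> b; rewrite mem_undup; exact: s0.
by apply: us => [|b]; rewrite ?undup_uniq ?mem_undup.
Qed.

Lemma mcomp_mpiece b u : mpiece b (mcomp b u).
Proof. by have [h _] := mcompP u. Qed.

Lemma mcomp_scale a x b u : mcomp (a + b)%MM ((x *: 'X_[a]) *: u) = (x *: 'X_[a]) *: mcomp b u.
Proof.
have [s [us s0 uE]] := sum_mcomp u.
rewrite {1}uE scaler_sumr mcomp_sum.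
under eq_bigr do rewrite (mcomp_piece _ (mpieceXZ a x (mcomp_mpiece _ u))) eqm_add2l.
have [bs|bs] := boolP (b \in s); last first.
  rewrite big1_seq ?s0 ?scaler0 // => c /andP[_ cs].
  by case: eqP => // bc; rewrite bc cs in bs.
rewrite (bigD1_seq b) //= eqxx big1 ?addr0 // => c cb.
by rewrite eq_sym (negPf cb).
Qed.

Lemma mcomp_scale0 a x b u : ~~ (a <= b)%MM -> mcomp b ((x *: 'X_[a]) *: u) = 0.
Proof.
move=> ab; have [s [us s0 uE]] := sum_mcomp u.
rewrite {1}uE scaler_sumr mcomp_sum big1 // => c _.
rewrite (mcomp_piece _ (mpieceXZ a x (mcomp_mpiece c u))).
by case: eqP => // bac; rewrite bac lem_addr in ab.
Qed.

Lemma mnm_push_id (b : 'X_{1..n}) : mnm_push id b = b.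
Proof. by apply/mnmP => j; rewrite mnmE big_pred1_eq. Qed.

Lemma pullback_id : pullback (M := M) id (@total_piece K n M) mcomp.
Proof.
split.
- exact: mcompD.
- by move=> b c u; have := mcomp_scale 0 c b u; rewrite add0m mpolyX0 alg_mpolyC.
- by move=> b v u; have := mcomp_scale U_(v) 1 b u; rewrite addmC scale1r.
- by move=> b v u bv; rewrite -['X_v]scale1r mcomp_scale0 // lep1mP bv.
- by move=> b u; rewrite mnm_push_id; exact: mcomp_mpiece.
- by move=> u u0; have [s [_ _ ->]] := sum_mcomp u; rewrite big1.
- by move=> u; have [s [_ s0 _]] := sum_mcomp u; exists s.
- move=> b y; rewrite mnm_push_id => by_; exists y; split.
  + exists [:: b], (fun=> y); split; last by rewrite big_seq1.
    by move=> a; rewrite inE => /eqP ->.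
  + by rewrite (mcomp_piece _ by_) eqxx.
  + by move=> c cb; rewrite (mcomp_piece _ by_) (negPf cb).
move=> e u; split=> [[s [f [fP ->]]] b be|u0].
  rewrite mcomp_sum big1_seq // => a /andP[_ /fP[fa ae]].
  rewrite (mcomp_piece _ fa); case: eqP => // ba.
  by rewrite ba ae eqxx in be.
have [s [us s0 uE]] := sum_mcomp u.
exists [seq b <- s | (mdeg b)%:Z == e], (mcomp ^~ u); split=> [a|].
  by rewrite mem_filter => /andP[/eqP ae _]; split; first exact: mcomp_mpiece.
by rewrite {1}uE big_filter [RHS]big_mkcond; apply: eq_bigr => b _; case: eqP => // /eqP/u0.
Qed.

End Components.

(** * The ideals (x^a)^* *)

Section MonomialStar.
Variables (K : fieldType) (n : nat) (i_ : 'I_n -> nat).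
Local Notation m := (\sum_(j < n) i_ j)%N.
Local Notation R := {mpoly K[m]}.
Local Notation push := (mnm_push (@tagnat.sig1 n i_)).

Lemma lep0m k (a : 'X_{1..k}) : (0 <= a)%MM.
Proof. by apply/mnm_lepP => i; rewrite mnm0E. Qed.

Definition mnm_ge (a : 'X_{1..n}) (f : R) : Prop :=
  forall b, ~~ (a <= push b)%MM -> f@_b = 0.

Lemma mnm_geM a b f g : mnm_ge a f -> mnm_ge b g -> mnm_ge (a + b)%MM (f * g).
Proof.
move=> af bg c abc; rewrite [g]mpolyE mulr_sumr raddf_sum /= big1 // => d _.
rewrite -scalerAr mcoeffZ mcoeffMXE; case: ifP => [dc|_]; last by rewrite mulr0.
have [bd|/bg->] := boolP (b <= push d)%MM; last by rewrite mul0r.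
rewrite af ?mulr0 //; apply: contra abc => ad.
rewrite -(submK dc) mnm_pushD; apply/mnm_lepP => i.
by rewrite !mnmDE leq_add //; apply/mnm_lepP.
Qed.

Lemma mnm_ge_closed a : ideal_closed (mnm_ge a).
Proof.
split=> [b|f g af ag b ab|c f af]; first by rewrite mcoeff0.
  by rewrite mcoeffD af ?ag ?addr0.
by rewrite -[a]add0m; apply: mnm_geM => // b; rewrite lep0m.
Qed.

Lemma ideal_mul_mnm_ge a b (I J : R -> Prop) :
  (forall f, I f -> mnm_ge a f) -> (forall f, J f -> mnm_ge b f) ->
  forall f, ideal_mul I J f -> mnm_ge (a + b)%MM f.
Proof.
move=> Ia Jb _ [r [c [g [IJg ->]]]].
apply: (@ideal_closed_sum _ (mnm_ge _) _ _ (fun i => c i * g i) (mnm_ge_closed _)) => i.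
have [x [y [Ix Jy ->]]] := IJg i.
by have [_ _ scale] := mnm_ge_closed (a + b)%MM; apply: scale; apply: mnm_geM; [exact: Ia | exact: Jb].
Qed.

Lemma mnm_ge_var_ideal_exp j k f :
  ideal_exp (@var_ideal K n i_ j) k f -> mnm_ge (U_(j) *+ k)%MM f.
Proof.
elim: k f => [|k IHk] f; first by move=> _ b; rewrite mulm0n lep0m.
rewrite mulmS /=; apply: (ideal_mul_mnm_ge _ IHk) => _ [r [c [g [gP ->]]]].
apply: (@ideal_closed_sum _ (mnm_ge _) _ _ (fun i => c i * g i) (mnm_ge_closed _)) => i.
have [_ _ scale] := mnm_ge_closed U_(j)%MM; apply: scale.
have [v [vj ->]] := gP i; move=> b; rewrite mcoeffX; case: eqP => // <-.
by rewrite mnm_pushU vj lepm_refl.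
Qed.

Lemma ideal_mulP (I J : R -> Prop) f g : I f -> J g -> ideal_mul I J (f * g).
Proof.
move=> If Jg; exists 1%N, (fun=> 1), (fun=> f * g); split=> [_|].
  by exists f, g.
by rewrite big_ord1 mul1r.
Qed.

Lemma var_ideal_expX j k b : (k <= push b j)%N ->
  ideal_exp (@var_ideal K n i_ j) k 'X_[b].
Proof.
elim: k b => [//|k IHk] b lt_kb.
have [v /andP[/eqP vj bv]] : exists v, (tagnat.sig1 v == j) && (b v != 0%N).
  have : push b j != 0%N by rewrite -lt0n (leq_ltn_trans _ lt_kb).
  rewrite mnmE sum_nat_eq0 negb_forall => /existsP[v].
  by rewrite negb_imply; exists v.
have Ub : (U_(v) <= b)%MM by rewrite lep1mP.
rewrite -(submK Ub) addmC mpolyXD; apply: ideal_mulP.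
  exists 1%N, (fun=> 1), (fun=> 'X_v); split=> [_|]; first by exists v.
  by rewrite big_ord1 mul1r.
by apply: IHk; rewrite mnm_pushB // mnmBE mnm1E vj eqxx; lia.
Qed.

Lemma monomial_starX a b : (a <= push b)%MM -> @monomial_star K n i_ a 'X_[b].
Proof.
move=> /mnm_lepP ab.
(* x^b is the product of its parts in the groups of variables, the j-th of which lies in
   P_j^{a(j)}. *)
pose part j : 'X_{1..m} := [multinom if tagnat.sig1 v == j then b v else 0%N | v < m].
have -> : b = (\sum_j part j)%MM.
  apply/mnmP => v; rewrite mnm_sumE [RHS](bigD1 (tagnat.sig1 v)) //= mnmE eqxx.
  by rewrite [X in (_ + X)%N]big1 ?addn0 // => j; rewrite eq_sym mnmE => /negPf->.
rewrite (big_morph _ (@mpolyXD m K) (@mpolyX0 m K)) /monomial_star.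
apply: (big_rec2 (fun (I : R -> Prop) f => I f)) => // j I f _ If.
apply: ideal_mulP => //; apply: var_ideal_expX; apply: leq_trans (ab j) _.
by rewrite !mnmE; apply: eq_leq; apply: eq_bigr => v vj; rewrite mnmE vj.
Qed.

(** P_j^k is spanned by the monomials of degree at least k in the variables of group j, and the
    product over j imposes all these bounds at once. *)
Lemma monomial_starP a f :
  @monomial_star K n i_ a f <-> forall b, ~~ (a <= push b)%MM -> f@_b = 0.
Proof.
split=> [|af].
  rewrite -/(mnm_ge a f) [in mnm_ge a](multinomUE_id a) /monomial_star.
  apply: (big_rec2 (fun (I : R -> Prop) c => forall f, I f -> mnm_ge c f)) f.
    by move=> f _ b; rewrite lep0m.
  move=> j c I _ Ic; apply: ideal_mul_mnm_ge => // f; exact: mnm_ge_var_ideal_exp.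
have [I0 ID IM] := @monomial_star_closed K n i_ a.
rewrite [f]mpolyE; apply: ideal_closed_sum => [|b]; first by [].
have [ab|/af->] := boolP (a <= push b)%MM; last by rewrite scale0r.
by rewrite -mul_mpolyC; apply/IM/monomial_starX.
Qed.

End MonomialStar.

(** * The expansion of M *)

Section Presentation.
Variables (K : fieldType) (n : nat).
Local Notation S := {mpoly K[n]}.

(* The element of multidegree [b] with coefficient vector [c] in the direct   *)
(* sum of the S(-a l); by truncated subtraction it is not homogeneous unless  *)
(* [mrow_supp a b c] holds.                                                   *)
Definition mrow r (a : 'I_r -> 'X_{1..n}) b (c : 'rV[K]_r) : 'rV[S]_r :=
  \row_l (c 0 l *: 'X_[b - a l]).

Definition mrow_supp r (a : 'I_r -> 'X_{1..n}) b (c : 'rV[K]_r) : Prop :=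
  forall l, ~~ (a l <= b)%MM -> c 0 l = 0.

Definition mrow_coef r (a : 'I_r -> 'X_{1..n}) b (v : 'rV[S]_r) : 'rV[K]_r :=
  \row_l (if (a l <= b)%MM then (v 0 l)@_(b - a l) else 0).

Lemma mrow_coef_supp r (a : 'I_r -> 'X_{1..n}) b v :
  mrow_supp a b (mrow_coef a b v).
Proof. by move=> l /negPf ab; rewrite mxE ab. Qed.

Lemma mrowD r (a : 'I_r -> 'X_{1..n}) b c c' :
  mrow a b (c + c') = mrow a b c + mrow a b c'.
Proof. by apply/rowP => l; rewrite !mxE scalerDl. Qed.

Lemma mrow0 r (a : 'I_r -> 'X_{1..n}) b : mrow a b 0 = 0.
Proof. by apply/rowP => l; rewrite !mxE scale0r. Qed.

Lemma mrowZ r (a : 'I_r -> 'X_{1..n}) b x c :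
  mrow a b (x *: c) = x%:MP *: mrow a b c.
Proof. by apply/rowP => l; rewrite !mxE mul_mpolyC scalerA. Qed.

Lemma mrowX r (a : 'I_r -> 'X_{1..n}) b j c : mrow_supp a b c ->
  mrow a (b + U_(j))%MM c = 'X_j *: mrow a b c.
Proof.
move=> cb; apply/rowP => l; rewrite !mxE -scalerAr -mpolyXD.
have [ab|/cb->] := boolP (a l <= b)%MM; last by rewrite !scale0r.
by rewrite addmBA // [(U_(j) + _)%MM]addmC.
Qed.

Lemma mrow_free_mpiece r (a : 'I_r -> 'X_{1..n}) b c : mrow_supp a b c ->
  free_mpiece a b (mrow a b c).
Proof.
move=> cb l x; rewrite mxE mcoeff_msupp mcoeffZ mcoeffX.
have [ab|/cb->] := boolP (a l <= b)%MM; last by rewrite mul0r eqxx.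
by case: (_ =P x) => [<- _|]; [rewrite submK | rewrite mulr0 eqxx].
Qed.

Section MultigradedMap.
Variables (r s : nat) (a : 'I_r -> 'X_{1..n}) (a' : 'I_s -> 'X_{1..n}).
Variable phi : mghom K a a'.

Lemma mghom_coef_le i l : mghom_coef phi i l != 0 -> (a' l <= a i)%MM.
Proof. by apply: contraNT => h; rewrite (mghom_coef0 phi h). Qed.

(** In a fixed multidegree phi is the scalar matrix [mghom_coef phi], and so is phi^* by
    [coef_row_star]; hence M^* has the components of M. *)
Lemma mghom_mrow b c : mrow_supp a b c ->
  mrow a b c *m mghom_mx phi = mrow a' b (c *m mghom_coef phi).
Proof.
move=> cb; apply/rowP => l; rewrite !mxE scaler_suml; apply: eq_bigr => i _.
rewrite !mxE -scalerAl -scalerAr -mpolyXD scalerA.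
have [->|/mghom_coef_le la] := eqVneq (mghom_coef phi i l) 0; first by rewrite mulr0 !scale0r.
have [ab|/cb->] := boolP (a i <= b)%MM; last by rewrite mul0r !scale0r.
by rewrite addmBA // submK.
Qed.

Lemma mghom_mrow_coef b (v : 'rV[S]_r) :
  mrow_coef a' b (v *m mghom_mx phi) = mrow_coef a b v *m mghom_coef phi.
Proof.
apply/rowP => l; rewrite !mxE; have [lb|lb] := ifP.
  rewrite raddf_sum; apply: eq_bigr => i _ /=; rewrite !mxE -scalerAr mcoeffZ mulrC.
  have [->|/mghom_coef_le la] := eqVneq (mghom_coef phi i l) 0; first by rewrite !mulr0.
  congr (_ * _); rewrite mcoeffMXE.
  have -> : (a i - a' l <= b - a' l)%MM = (a i <= b)%MM.
    apply/mnm_lepP/mnm_lepP => h i'; have := h i'; rewrite !mnmBE;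
      have := elimT mnm_lepP la i'; have := elimT mnm_lepP lb i'; lia.
  case: ifP => // ib; congr (_ @__); apply/mnmP => i'; rewrite !mnmBE.
  by have := elimT mnm_lepP la i'; have := elimT mnm_lepP ib i'; lia.
rewrite big1 // => i _; rewrite mxE.
have [->|/mghom_coef_le la] := eqVneq (mghom_coef phi i l) 0; first by rewrite mulr0.
case: ifP => [ib|]; last by rewrite mul0r.
by rewrite (lepm_trans la ib) in lb.
Qed.

End MultigradedMap.

Variables (M : multigradedModule K n) (F : free_presentation M).
Local Notation a0 := (pres_shift0 F).

Lemma mcomp_pres_aug b v : mcomp b (pres_aug F v) = pres_aug F (mrow a0 b (mrow_coef a0 b v)).
Proof.
suff : is_mcomp (pres_aug F v) (fun b => pres_aug F (mrow a0 b (mrow_coef a0 b v))).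
  by move/(is_mcomp_uniq (mcompP _)); apply.
split=> [c|]; first exact/pres_aug_graded/mrow_free_mpiece/mrow_coef_supp.
exists [seq (x + a0 l)%MM | l <- enum 'I_(pres_rank0 F), x <- msupp (v 0 l)].
  move=> c cs; rewrite (_ : mrow_coef _ _ _ = 0) ?mrow0 ?linear0 //.
  apply/rowP => l; rewrite !mxE; case: ifP => // lc; apply: memN_msupp_eq0.
  apply: contra cs => cv; apply/allpairsPdep; exists l, (c - a0 l)%MM.
  by rewrite mem_enum submK.
move=> s us sub; rewrite -linear_sum; congr (pres_aug F _); apply/rowP => l.
apply/mpolyP => x; rewrite summxE raddf_sum /=.
have coefE c : (mrow a0 c (mrow_coef a0 c v) 0 l)@_x =
    if c == (x + a0 l)%MM then (v 0 l)@_x else 0.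
  rewrite !mxE mcoeffZ mcoeffX; case: ifP => [lc|lc].
    rewrite -[c](submK lc) (inj_eq (@addIm _ _)) addmK.
    by case: eqP => [->|_]; rewrite ?mulr1 ?mulr0.
  by rewrite mul0r; case: eqP => // cx; rewrite cx lem_addl in lc.
under eq_bigr do rewrite coefE.
have [xs|xs] := boolP ((x + a0 l)%MM \in s).
  rewrite (bigD1_seq _ xs us) /= eqxx big1 ?addr0 // => c /negPf -> //.
rewrite big1_seq => [|c /andP[_ cs]]; last by case: eqP => // cx; rewrite -cx cs in xs.
apply: memN_msupp_eq0; apply: contra xs => xv; apply: sub; apply/allpairsPdep.
by exists l, x; rewrite mem_enum.
Qed.

(** The summands with shift not below b contribute spurious elements by truncated subtraction, which
    [fin_dim] tolerates. *)
Lemma fin_dim_mpiece b : fin_dim (mpiece b : M -> Prop).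
Proof.
exists (pres_rank0 F), (fun l => 'X_[b - a0 l] *: pres_aug F (delta_mx 0 l)) => y hy.
have [v vy] := pres_aug_surj F y; exists (mrow_coef a0 b v).
have := mcomp_pres_aug b v; rewrite vy (mcomp_piece _ hy) eqxx => ->.
rewrite [mrow _ _ _]row_sum_delta linear_sum; apply: eq_bigr => l _.
by rewrite linearZ mxE /= -mul_mpolyC scalerA.
Qed.

Section Expansion.
Variable i_ : 'I_n -> nat.
Local Notation m := (\sum_(j < n) i_ j)%N.
Local Notation R := {mpoly K[m]}.
Local Notation push := (mnm_push (@tagnat.sig1 n i_)).
Local Notation phi := (pres_map F).
Local Notation N := (expansion i_ F).

Definition coef_row r (b : 'X_{1..m}) (w : 'rV[R]_r) : 'rV[K]_r :=
  map_mx (mcoeff b) w.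

Lemma coef_rowD r b (u w : 'rV[R]_r) : coef_row b (u + w) = coef_row b u + coef_row b w.
Proof. by apply/rowP => l; rewrite !mxE mcoeffD. Qed.

Lemma coef_row_free_star r (a : 'I_r -> 'X_{1..n}) b (w : free_star K i_ a) :
  mrow_supp a (push b) (coef_row b (free_star_val w)).
Proof.
case: w => w /= /asboolP hw l lb; rewrite mxE.
by have /monomial_starP := hw l; exact.
Qed.

Lemma free_starI r (a : 'I_r -> 'X_{1..n}) (w : 'rV[R]_r) :
  (forall b, mrow_supp a (push b) (coef_row b w)) ->
  w \in free_star_pred a.
Proof.
move=> hw; apply/asboolP => l; apply/monomial_starP => b lb.
by have := hw b l lb; rewrite mxE.
Qed.

(** The entries of phi^* are constants, so it acts on the coefficients of each monomial
    separately. *)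
Lemma coef_row_star r s (a : 'I_r -> 'X_{1..n}) (a' : 'I_s -> 'X_{1..n})
    (f : mghom K a a') b (u : 'rV[R]_r) :
  coef_row b (u *m star_mx i_ f) = coef_row b u *m mghom_coef f.
Proof.
apply/rowP => l; rewrite !mxE raddf_sum; apply: eq_bigr => i _ /=.
rewrite !mxE mulrC; case: ifP => [_|/negbT h]; first by rewrite mcoeffCM mulrC.
by rewrite (mghom_coef0 f h) mul0r mcoeff0 mulr0.
Qed.

Definition star_comp (b : 'X_{1..m}) (w : free_star K i_ a0) : M :=
  pres_aug F (mrow a0 (push b) (coef_row b (free_star_val w))).

Lemma star_compD b : {morph star_comp b : u w / u + w}.
Proof. by move=> u w; rewrite /star_comp coef_rowD mrowD linearD. Qed.

Lemma star_comp_im b u : star_comp b (star_map phi u) = 0.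
Proof.
apply/pres_exact; exists (mrow (pres_shift1 F) (push b) (coef_row b (free_star_val u))).
by rewrite mghom_mrow ?coef_row_star //; exact: coef_row_free_star.
Qed.

(** By exactness of the presentation in multidegree [push b], the coefficient vector of w at x^b is
    the image of some vector [c b]; these vectors are assembled into u. *)
Lemma star_comp_eq0 w : (forall b, star_comp b w = 0) ->
  exists u, star_map phi u = w.
Proof.
move=> w0; pose a1 := pres_shift1 F.
have /choice[c cP] (b : 'X_{1..m}) : exists c : 'rV[K]_(pres_rank1 F),
    mrow_supp a1 (push b) c /\ coef_row b (free_star_val w) = c *m mghom_coef phi.
  have /pres_exact[v vE] := w0 b.
  exists (mrow_coef a1 (push b) v); split; first exact: mrow_coef_supp.
  rewrite -mghom_mrow_coef -vE; apply/rowP => l; rewrite !mxE.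
  case: ifP => [_|/negbT lb]; first by rewrite mcoeffZ mcoeffX eqxx mulr1.
  by have := coef_row_free_star w lb; rewrite mxE.
pose N := (\max_l msize (free_star_val w ord0 l))%N.
(* The chosen [c b] may be nonzero for infinitely many b; cutting at N, beyond which w has no
   coefficients, makes u polynomial. *)
pose c' b := if (mdeg b < N)%N then c b else 0.
have c'P b : mrow_supp a1 (push b) (c' b) /\
    coef_row b (free_star_val w) = c' b *m mghom_coef phi.
  rewrite /c'; case: ltnP => [_|Nb]; first exact: cP.
  split=> [l _|]; first by rewrite mxE.
  rewrite mul0mx; apply/rowP => l; rewrite !mxE; apply: mcoeff_msize.
  by apply: leq_trans Nb; apply: (leq_bigmax (F := fun l => msize (free_star_val w ord0 l))).
pose u : 'rV[R]_(pres_rank1 F) := \row_i mpoly_of N (fun b => c' b 0 i).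
have uE b : coef_row b u = c' b.
  apply/rowP => i; rewrite !mxE mcoeff_mpoly_of // => d Nd.
  by rewrite /c' ltnNge Nd mxE.
have us : u \in free_star_pred a1.
  by apply: free_starI => b; rewrite uE; case: (c'P b).
exists (FreeStar us); apply: val_inj => /=; apply/rowP => l; apply/mpolyP => b.
have := coef_row_star phi b u; rewrite uE; have [_ <-] := c'P b.
by move/rowP/(_ l); rewrite !mxE.
Qed.

Definition expansion_comp (b : 'X_{1..m}) (q : N) : M := star_comp b (repr q).

Lemma expansion_comp_proj b w :
  expansion_comp b (coker_proj (star_map phi) w) = star_comp b w.
Proof.
rewrite /expansion_comp; set w' := repr _.
have /coker_projP[u uE] : coker_proj (star_map phi) w' = coker_proj (star_map phi) w.
  by rewrite {1}/coker_proj reprK.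
by rewrite -[w'](subrK w) -uE star_compD star_comp_im add0r.
Qed.

(** At x^b, M^* is the cokernel of the scalar matrix of phi on the summands with shift below
    [push b], which is also M in multidegree [push b]. *)
Lemma pullback_expansion :
  pullback (M := M) (@tagnat.sig1 n i_) (@expansion_piece K n i_ M F) expansion_comp.
Proof.
have surj (q : N) : exists w, coker_proj (star_map phi) w = q := coker_proj_surj q.
split.
- move=> b u v; have [w <-] := surj u; have [w' <-] := surj v.
  by rewrite -linearD /= !expansion_comp_proj star_compD.
- move=> b c u; have [w <-] := surj u.
  rewrite -linearZ /= !expansion_comp_proj /star_comp -linearZ /= -mrowZ.
  by congr (pres_aug F (mrow _ _ _)); apply/rowP => l; rewrite !mxE mcoeffCM.
- move=> b v u; have [w <-] := surj u.
  rewrite -linearZ /= !expansion_comp_proj /star_comp -linearZ /= mnm_pushD mnm_pushU.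
  rewrite -mrowX; last exact: coef_row_free_star.
  by congr (pres_aug F (mrow _ _ _)); apply/rowP => l; rewrite !mxE mulrC mcoeffMXE lem_addl addmK.
- move=> b v u bv; have [w <-] := surj u.
  rewrite -linearZ /= expansion_comp_proj /star_comp.
  rewrite (_ : coef_row _ _ = 0) ?mrow0 ?linear0 //.
  by apply/rowP => l; rewrite !mxE mcoeffXM bv.
- by move=> b u; apply/pres_aug_graded/mrow_free_mpiece/coef_row_free_star.
- move=> u; have [w <-] := surj u => w0.
  have [|x xw] := star_comp_eq0 (w := w).
    by move=> b; rewrite -expansion_comp_proj w0.
  by rewrite -[RHS](linear0 (coker_proj (star_map phi))); apply/coker_projP; exists x; rewrite subr0.
- move=> u; have [w <-] := surj u.
  exists (flatten [seq msupp (free_star_val w 0 l) | l <- enum 'I_(pres_rank0 F)]) => b bs.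
  rewrite expansion_comp_proj /star_comp (_ : coef_row _ _ = 0) ?mrow0 ?linear0 //.
  apply/rowP => l; rewrite !mxE; apply: memN_msupp_eq0; apply: contra bs => bw.
  by apply/flatten_mapP; exists l; rewrite ?mem_enum.
- move=> b y hy; have [v vy] := pres_aug_surj F y.
  pose c := mrow_coef a0 (push b) v.
  have yE : pres_aug F (mrow a0 (push b) c) = y.
    by rewrite -mcomp_pres_aug vy (mcomp_piece _ hy) eqxx.
  pose w : 'rV[R]_(pres_rank0 F) := \row_l (c 0 l *: 'X_[b]).
  have wE d : coef_row d w = if d == b then c else 0.
    by apply/rowP => l; rewrite !mxE mcoeffZ mcoeffX eq_sym; case: eqP; rewrite ?mulr1 ?mulr0 !mxE.
  have ws : w \in free_star_pred a0.
    apply: free_starI => d; rewrite wE; case: eqP => [->|_] l; last by rewrite mxE.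
    exact: mrow_coef_supp.
  exists (coker_proj (star_map phi) (FreeStar ws)); split.
  + exists (FreeStar ws); split=> // l x; rewrite /= mxE mcoeff_msupp mcoeffZ mcoeffX.
    by case: (_ =P x) => [->|]; rewrite ?addr0 ?mulr0 ?eqxx.
  + by rewrite expansion_comp_proj /star_comp /= wE eqxx.
  + by move=> d db; rewrite expansion_comp_proj /star_comp /= wE (negPf db) mrow0 linear0.
move=> e u; split=> [[w [we <-]] b be|u0].
  rewrite expansion_comp_proj /star_comp (_ : coef_row _ _ = 0) ?mrow0 ?linear0 //.
  apply/rowP => l; rewrite !mxE; apply: memN_msupp_eq0; apply: contra be => bw.
  by rewrite -(we l b bw) addr0.
have [w wu] := surj u.
(* The part of degree e of w represents the same class, because the components of u in other degrees
   vanish. *)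
pose w' : 'rV[R]_(pres_rank0 F) := \row_l mpoly_of (msize (free_star_val w 0 l))
  (fun b => if (mdeg b)%:Z == e then (free_star_val w 0 l)@_b else 0).
have w'E b : coef_row b w' = if (mdeg b)%:Z == e then coef_row b (free_star_val w) else 0.
  apply/rowP => l; rewrite !mxE mcoeff_mpoly_of => [|d Nd].
    by case: (_ == e); rewrite !mxE.
  by rewrite mcoeff_msize ?if_same.
have ws : w' \in free_star_pred a0.
  apply: free_starI => b; rewrite w'E; case: (_ == e); first exact: coef_row_free_star.
  by move=> l _; rewrite mxE.
exists (FreeStar ws); split.
  move=> l x; rewrite addr0; apply: contraTeq => /negPf xe; rewrite mcoeff_msupp negbK.
  by have /rowP/(_ l) := w'E x; rewrite xe !mxE => ->.
rewrite -wu; apply/coker_projP; apply: star_comp_eq0 => b.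
have : star_comp b (FreeStar ws) = star_comp b w.
  rewrite {1}/star_comp /= w'E; case: eqP => // /eqP be.
  by rewrite mrow0 linear0 -expansion_comp_proj wu u0.
by rewrite -{1}[FreeStar ws](subrK w) star_compD => /(canRL (addrK _)); rewrite subrr.
Qed.

End Expansion.
End Presentation.

(** * Comparison of M with its expansion *)

Unset Implicit Arguments.

Theorem corollary4p3 (K : fieldType) (n : nat) (i_ : 'I_n -> nat)
    (i_gt0 : forall j, (0 < i_ j)%N)
    (M : multigradedModule K n) (M_fg : finitely_generated M)
    (F : free_presentation M) (d : int) :
  has_linear_resolution d (@total_piece K n M) <->
  has_linear_resolution d (@expansion_piece K n i_ M F).
Proof.
have finM := fin_dim_mpiece F.
rewrite (linear_resolution_pullback (pullback_id M) finM); last by move=> j; exists j.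
rewrite (linear_resolution_pullback (pullback_expansion F i_) finM) // => j.
(* Positivity of [i_ j] provides a variable in each group, so [tagnat.sig1] is onto. *)
by exists (tagnat.Rank j (Ordinal (i_gt0 j))); rewrite tagnat.Rank1K.
Qed.
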